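(* Let $(\bm u_h^n,\xi_h^n,p_h^n)\in\bm V_h\times W_h\times M_h$, $0\le n\le N$, be produced by the reformulated Crank-Nicolson coupled algorithm: starting from given $(\bm u_h^0,\xi_h^0,p_h^0)\in\bm V_h\times W_h\times M_h$, for $n=1,\dots,N$, \begin{align*} &a_1(\bm u_h^n,\bm v_h)-b(\bm v_h,\xi_h^n)=(\bm f^n,\bm v_h)+\langle\bm f_1^n,\bm v_h\rangle_{\Gamma_\sigma}&&\forall\bm v_h\in\bm V_h,\\ &b(\bm u_h^n,\phi_h)+a_2(\xi_h^n,\phi_h)-c(p_h^n,\phi_h)=0&&\forall\phi_h\in W_h,\\ &a_3\Big(\tfrac{p_h^n-p_h^{n-1}}{\Delta t},\psi_h\Big)-c\Big(\psi_h,\tfrac{\xi_h^n-\xi_h^{n-1}}{\Delta t}\Big)+d\Big(\tfrac{p_h^n+p_h^{n-1}}2,\psi_h\Big)\\ &\qquad=\tfrac12(g^n+g^{n-1},\psi_h)+\tfrac12\langle g_1^n+g_1^{n-1},\psi_h\rangle_{\Gamma_q}&&\forall\psi_h\in M_h. \end{align*} Let $\{(\bm u_h^{n,i},\xi_h^{n,i},p_h^{n,i})\}_{i\ge0,\,0\le n\le N}$ be generated by the global-in-time iterative decoupled algorithm: $(\bm u_h^{n,0},\xi_h^{n,0},p_h^{n,0})=(\bm u_h^0,\xi_h^0,p_h^0)$ for $n=0,\dots,N$, and for $i=1,2,\dots$, set $(\bm u_h^{0,i},\xi_h^{0,i},p_h^{0,i})=(\bm u_h^0,\xi_h^0,p_h^0)$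 and: Step a: successively for $n=1,\dots,N$, find $p_h^{n,i}\in M_h$ such that for all $\psi_h\in M_h$ $$a_3\Big(\tfrac{p_h^{n,i}-p_h^{n-1,i}}{\Delta t},\psi_h\Big)-c\Big(\psi_h,\tfrac{\xi_h^{n,i-1}-\xi_h^{n-1,i-1}}{\Delta t}\Big)+d\Big(\tfrac{p_h^{n,i}+p_h^{n-1,i}}2,\psi_h\Big)=\tfrac12(g^n+g^{n-1},\psi_h)+\tfrac12\langle g_1^n+g_1^{n-1},\psi_h\rangle_{\Gamma_q};$$ Step b: for each $n=1,\dots,N$ (in parallel), find $(\bm u_h^{n,i},\xi_h^{n,i})\in\bm V_h\times W_h$ such that \begin{align*} a_1(\bm u_h^{n,i},\bm v_h)-b(\bm v_h,\xi_h^{n,i})&=(\bm f^n,\bm v_h)+\langle\bm f_1^n,\bm v_h\rangle_{\Gamma_\sigma}&&\forall\bm v_h\in\bm V_h,\\ b(\bm u_h^{n,i},\phi_h)+a_2(\xi_h^{n,i},\phi_h)&=c(p_h^{n,i},\phi_h)&&\forall\phi_h\in W_h. \end{align*} Set $e_{\bm u,g}^{n,i}=\bm u_h^{n,i}-\bm u_h^n$, $e_{\xi,g}^{n,i}=\xi_h^{n,i}-\xi_h^n$, $e_{p,g}^{n,i}=p_h^{n,i}-p_h^n$. Then, for every $0\le n\le N$, $(\bm u_h^{n,i},\xi_h^{n,i},p_h^{n,i})$ converges to $(\bm u_h^n,\xi_h^n,p_h^n)$ in $\bm V_h\times W_h\times M_h$ as $i\to\infty$, and for all $i\ge1$ $$\sum_{n=1}^N\|e_{\xi,g}^{n,i}-e_{\xi,g}^{n-1,i}\|_{L^2(\Omega)}^2\le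 L_g\sum_{n=1}^N\|e_{\xi,g}^{n,i-1}-e_{\xi,g}^{n-1,i-1}\|_{L^2(\Omega)}^2,$$ where $$L_g=\frac{1}{\left(\frac{c_0\lambda}{\alpha^2}+1\right)\left(C(\tilde\beta,\mu)\lambda+1\right)}$$ is a positive constant strictly smaller than $1$, and $C(\tilde\beta,\mu)>0$ is a constant depending only on $\tilde\beta$ and $\mu$. Moreover, for all $i\ge1$, $$\|e_{p,g}^{N,i}\|_{H^1(\Omega)}^2\lesssim\sum_{n=1}^N\|e_{\xi,g}^{n,i-1}-e_{\xi,g}^{n-1,i-1}\|_{L^2(\Omega)}^2,$$ $$\|e_{\xi,g}^{N,i}\|_{L^2(\Omega)}\lesssim\|e_{\bm u,g}^{N,i}\|_{H^1(\Omega)}\lesssim\|e_{p,g}^{N,i}\|_{H^1(\Omega)}.$$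
   Context: Setting: $\Omega\subset\mathbb{R}^d$ ($d=2,3$) is a bounded polygonal (polyhedral) domain with $\partial\Omega=\Gamma_{\bm u}\cup\Gamma_\sigma=\Gamma_p\cup\Gamma_q$, $\Gamma_{\bm u}\cap\Gamma_\sigma=\Gamma_p\cap\Gamma_q=\emptyset$, $|\Gamma_{\bm u}|>0$, $|\Gamma_p|>0$, and $T>0$. The parameters satisfy $\lambda,\mu,\alpha,k_p>0$ and $c_0\ge 0$. The data $\bm f,\bm f_1,g,g_1$ (body force, boundary traction on $\Gamma_\sigma$, source, flux on $\Gamma_q$) are sufficiently smooth functions of time and space. The interval $[0,T]$ is partitioned as $0=t_0<t_1<\dots<t_N=T$ with uniform step $\Delta t$; a superscript $n$ on data denotes evaluation at $t_n$. $(\cdot,\cdot)$ is the $L^2(\Omega)$ inner product and $\langle\cdot,\cdot\rangle_\Gamma$ the $L^2(\Gamma)$ inner product; $\varepsilon(\bm u)=\frac12[\nabla\bm u+(\nabla\bm u)^T]$. For $\Gamma\subset\partial\Omega$, $H^1_{0,\Gamma}(\Omega)=\{v\in H^1(\Omega): v=0\text{ on }\Gamma\}$, and bold letters denote $\mathbb{R}^d$-valued versions. Bilinear forms: $a_1(\bm u,\bm v)=2\mu\int_\Omega\varepsilon(\bm u):\varepsilon(\bm v)$, $b(\bm v,\phi)=\int_\Omega\phi\,\mathrm{div}\,\bm v$, $a_2(\xi,\phi)=\frac1\lambda\int_\Omega\xi\phi$, $c(p,\phi)=\frac\alpha\lambda\int_\Omega p\phi$, $a_3(p,\psi)=\left(c_0+\frac{\alpha^2}{\lambda}\right)\int_\Omega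 p\psi$, $d(p,\psi)=k_p\int_\Omega\nabla p\cdot\nabla\psi$. Finite element spaces on a partition $\mathcal T_h$ of $\Omega$ into triangles/tetrahedra (maximum diameter $h$), with integers $k\ge2$, $l\ge1$: $\bm V_h=\{\bm v_h\in\bm H^1_{0,\Gamma_{\bm u}}(\Omega)\cap\bm C^0(\bar\Omega):\bm v_h|_E\in\bm P_k(E)\ \forall E\in\mathcal T_h\}$, $W_h=\{\phi_h\in L^2(\Omega)\cap C^0(\bar\Omega):\phi_h|_E\in P_{k-1}(E)\ \forall E\in\mathcal T_h\}$, $M_h=\{\psi_h\in H^1_{0,\Gamma_p}(\Omega)\cap C^0(\bar\Omega):\psi_h|_E\in P_l(E)\ \forall E\in\mathcal T_h\}$. The pair $(\bm V_h,W_h)$ satisfies the discrete inf-sup condition: there is $\tilde\beta>0$ independent of $h$ with $\sup_{\bm v_h\in\bm V_h}\frac{b(\bm v_h,\phi_h)}{\|\bm v_h\|_{H^1(\Omega)}}\ge\tilde\beta\|\phi_h\|_{L^2(\Omega)}$ for all $\phi_h\in W_h$. Korn's inequality holds: $\|\bm v\|_{H^1(\Omega)}\le C_K\|\varepsilon(\bm v)\|_{L^2(\Omega)}$ for all $\bm v\in\bm H^1_{0,\Gamma_{\bm u}}(\Omega)$. The Poincaré inequality $\|\psi\|_{L^2(\Omega)}\le C_P\|\nabla\psi\|_{L^2(\Omega)}$ holds for all $\psi\in H^1_{0,\Gamma_p}(\Omega)$. Notation: $x\lesssim y$ means $x\le Cy$ with a constant $C>0$ independent of the mesh size $h$ and of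 the iteration index $i$ ($C$ may depend on $\Delta t$, the physical parameters and $\Omega$). *)

(* Defs.v *)
From HB Require Import structures.
From mathcomp Require Import all_boot all_order all_algebra.
From mathcomp Require Import all_classical all_reals all_analysis.
From mathcomp Require Import measurable_realfun measurable_fun_approximation.
From mathcomp Require mpoly.
(* The notations of mpoly clash with those of analysis. *)
Import (canonicals, coercions) mpoly.

Set Implicit Arguments.
Unset Strict Implicit.
Unset Printing Implicit Defensive.

Import Order.TTheory GRing.Theory Num.Theory.
Import numFieldNormedType.Exports.

Local Open Scope classical_set_scope.
Local Open Scope ring_scope.

(* R^n carries the product (Borel) sigma-algebra. *)
Definition rV_display : measure_display. Proof. exact. Qed.

Section MeasurableRowVectors.
Variables (R : realType) (n : nat).

Let coor (i : 'I_n) (x : 'rV[R]_n) : R := x 0 i.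

Let rV_set0 : g_sigma_preimage coor set0.
Proof. exact: sigma_algebra0. Qed.

Let rV_setC A : g_sigma_preimage coor A -> g_sigma_preimage coor (~` A).
Proof. exact: sigma_algebraC. Qed.

Let rV_bigcup (F : (set 'rV[R]_n)^nat) :
  (forall i, g_sigma_preimage coor (F i)) ->
  g_sigma_preimage coor (\bigcup_i (F i)).
Proof. exact: sigma_algebra_bigcup. Qed.

HB.instance Definition _ := @isMeasurable.Build rV_display 'rV[R]_n
  (g_sigma_preimage coor) rV_set0 rV_setC rV_bigcup.

Lemma measurable_coor (i : 'I_n) :
  measurable_fun [set: 'rV[R]_n] (fun x : 'rV[R]_n => x 0 i).
Proof.
move=> _ Y mY; rewrite setTI; apply: sub_sigma_algebra => /=.
rewrite -bigcup_seq/=; exists i => /=; first by rewrite mem_index_enum.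
by exists Y => //; rewrite setTI.
Qed.

Lemma measurable_fun_rVP d (T : measurableType d) (f : T -> 'rV[R]_n) :
  measurable_fun [set: T] f <->
  forall i, measurable_fun [set: T] (fun t => f t 0 i).
Proof.
split=> [mf i|mf]; first exact: (measurableT_comp (measurable_coor i) mf).
have sub : g_sigma_preimage coor `<=` [set A | measurable (f @^-1` A)].
  apply: smallest_sub.
    split => [|A|F mF] /=; first by rewrite preimage_set0.
    - by move=> mA; rewrite setTD preimage_setC; exact: measurableC.
    - by rewrite preimage_bigcup; apply: bigcup_measurable => k _; exact: mF.
  rewrite -bigcup_seq => A [i _] [B mB <-] /=.
  by rewrite setTI; have := mf i measurableT B mB; rewrite setTI.
by move=> _ Y mY; rewrite setTI; exact: sub.
Qed.

End MeasurableRowVectors.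

(* Lebesgue measure on R^n as an iterated product measure. *)
Section LebesgueMeasure.
Variable R : realType.

Definition rV_cons n (z : R * 'rV[R]_n) : 'rV[R]_n.+1 :=
  \row_i (if unlift ord0 i is Some j then z.2 0 j else z.1).

Definition rV_uncons n (x : 'rV[R]_n.+1) : R * 'rV[R]_n :=
  (x 0 ord0, \row_j x 0 (lift ord0 j)).

Fixpoint leb n : set 'rV[R]_n -> \bar R :=
  if n is m.+1
  then pushforward (product_measure1 lebesgue_measure (@leb m))
                   (@rV_cons m)
  else dirac (0 : 'rV[R]_0).
Arguments leb : clear implicits.

Lemma rV_consK n : cancel (@rV_cons n) (@rV_uncons n).
Proof.
move=> [a v]; rewrite /rV_uncons /rV_cons mxE unlift_none; congr pair.
by apply/rowP => j; rewrite !mxE liftK.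
Qed.

Lemma rV_unconsK n : cancel (@rV_uncons n) (@rV_cons n).
Proof.
move=> x; apply/rowP => i; rewrite mxE.
by case: unliftP => [j ->|->]; rewrite /= ?mxE.
Qed.

Lemma measurable_rV_cons n : measurable_fun setT (@rV_cons n).
Proof.
apply/measurable_fun_rVP => i.
case: (unliftP ord0 i) => [j ->|->].
  rewrite (_ : (fun t => _) = (fun x : 'rV[R]_n => x 0 j) \o snd); last first.
    by apply/funext => z /=; rewrite mxE liftK.
  by apply: measurableT_comp => //; exact: measurable_coor.
rewrite (_ : (fun t => _) = fst) //.
by apply/funext => z /=; rewrite mxE unlift_none.
Qed.

Lemma measurable_rV_uncons n : measurable_fun setT (@rV_uncons n).
Proof.
apply/measurable_fun_pairP; split => /=; first exact: measurable_coor.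
apply/measurable_fun_rVP => i /=.
under eq_fun do rewrite mxE.
exact: measurable_coor.
Qed.

Section Step.
Variables (n : nat) (mu : {sigma_finite_measure set 'rV[R]_n -> \bar R}).

Let step := pushforward (product_measure1 (@lebesgue_measure R) mu)
                        (@rV_cons n).

Let step_set0 : step set0 = 0%E.
Proof. by rewrite /step /pushforward preimage_set0 measure0. Qed.

Let step_ge0 A : (0 <= step A)%E.
Proof. by apply: integral_ge0 => x _ /=; exact: measure_ge0. Qed.

Let preimage_measurable (A : set 'rV[R]_n.+1) :
  measurable A -> measurable (@rV_cons n @^-1` A).
Proof.
by move=> mA; have := @measurable_rV_cons n measurableT A mA; rewrite setTI.
Qed.

Let step_sigma_additive : semi_sigma_additive step.
Proof.
move=> F mF tF mUF; rewrite /step /pushforward preimage_bigcup.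
apply: measure_semi_sigma_additive.
- by move=> k; exact: preimage_measurable.
- apply/trivIsetP => i j _ _ ij; rewrite -preimage_setI.
  by move/trivIsetP : tF => /(_ _ _ _ _ ij) ->//; rewrite preimage_set0.
- by rewrite -preimage_bigcup; exact: preimage_measurable.
Qed.

HB.instance Definition _ := isMeasure.Build _ _ _ step
  step_set0 step_ge0 step_sigma_additive.

Let step_sigma_finite : sigma_finite setT step.
Proof.
have /sigma_finiteP[F [TF ndF Foo]] := sigma_finiteT (@lebesgue_measure R).
have /sigma_finiteP[G [TG ndG Goo]] := sigma_finiteT mu.
exists (fun k => @rV_uncons n @^-1` (F k `*` G k)).
  apply/esym/seteqP; split => // x _.
  have [i _ Fi] : (\bigcup_k F k) (rV_uncons x).1 by rewrite -TF.
  have [j _ Gj] : (\bigcup_k G k) (rV_uncons x).2 by rewrite -TG.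
  exists (maxn i j) => //; split.
    by move: Fi; exact/subsetPset/ndF/leq_maxl.
  by move: Gj; exact/subsetPset/ndG/leq_maxr.
move=> k; have [mF Ffin] := Foo k; have [mG Gfin] := Goo k; split.
  have := @measurable_rV_uncons n measurableT _ (measurableX mF mG).
  by rewrite setTI.
rewrite /step /pushforward (_ : _ @^-1` _ = F k `*` G k); last first.
  by apply/funext => z; rewrite /preimage /mkset rV_consK.
by rewrite product_measure1E// lte_mul_pinfty// ge0_fin_numE.
Qed.

HB.instance Definition _ := Measure_isSigmaFinite.Build _ _ _ step
  step_sigma_finite.

Lemma leb_step : exists nu : {sigma_finite_measure set 'rV[R]_n.+1 -> \bar R},
  step = nu :> (set _ -> _).
Proof. by exists [the {sigma_finite_measure set 'rV[R]_n.+1 -> \bar R} of step]. Qed.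

End Step.

Lemma leb_structure n :
  exists mu : {sigma_finite_measure set 'rV[R]_n -> \bar R},
    leb n = mu :> (set 'rV[R]_n -> \bar R).
Proof.
elim: n => [|n [mu IH]] /=; first by exists (dirac (0 : 'rV[R]_0)).
by rewrite IH; exact: leb_step.
Qed.

End LebesgueMeasure.
Arguments leb : clear implicits.

Section LebesgueInstance.
Variables (R : realType) (n : nat).

Let leb_set0 : leb R n set0 = 0%E.
Proof. by have [mu ->] := leb_structure R n; rewrite measure0. Qed.

Let leb_ge0 A : (0 <= leb R n A)%E.
Proof. by have [mu ->] := leb_structure R n; exact: measure_ge0. Qed.

Let leb_sigma_additive : semi_sigma_additive (leb R n).
Proof.
by have [mu ->] := leb_structure R n; exact: measure_semi_sigma_additive.
Qed.

HB.instance Definition _ := isMeasure.Build _ _ _ (leb R n)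
  leb_set0 leb_ge0 leb_sigma_additive.

Let leb_sigma_finite : sigma_finite setT (leb R n).
Proof. by have [mu ->] := leb_structure R n; exact: sigma_finiteT. Qed.

HB.instance Definition _ := Measure_isSigmaFinite.Build _ _ _
  (leb R n) leb_sigma_finite.

End LebesgueInstance.

Section Simplices.
Variables (R : realType) (d : nat).
Local Notation pt := 'rV[R]_d.

Section OneSimplex.
Variable m : nat.
Implicit Types V W : 'M[R]_(m.+1, d).

(* An m-simplex of R^d is given by the matrix whose rows are its m+1 vertices;
   J selects the vertices that span a face. *)
Definition hull V (J : pred 'I_m.+1) : set pt :=
  [set x | exists t : 'rV[R]_m.+1,
    [/\ forall i, 0 <= t 0 i, \sum_i t 0 i = 1,
        forall i, ~~ J i -> t 0 i = 0 & x = t *m V]].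

Definition simplex V : set pt := hull V xpredT.

Definition common_face V W : set pt :=
  hull V [pred i | [exists j, row i V == row j W]].

Definition edges V : 'M[R]_(m, d) :=
  \matrix_(j, k) (V (lift ord0 j) k - V ord0 k).

Definition chart V (s : 'rV[R]_m) : pt := row ord0 V + s *m edges V.

(* Square root of the Gram determinant of the edge vectors. *)
Definition area_factor V : R := Num.sqrt (\det (edges V *m (edges V)^T)).

Definition unit_simplex : set 'rV[R]_m :=
  [set s | (forall i, 0 <= s 0 i) /\ \sum_i s 0 i <= 1].

End OneSimplex.

(* A conforming (face-to-face) partition of A into nondegenerate simplices. *)
Definition triangulates m (S : seq 'M[R]_(m.+1, d)) (A : set pt) : Prop :=
  [/\ forall V, V \in S -> row_free (edges V),
      A = [set x | exists2 V, V \in S & simplex V x],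
      uniq S &
      forall V W, V \in S -> W \in S -> V != W ->
        simplex V <> simplex W /\ simplex V `&` simplex W = common_face V W].

(* m-dimensional area carried by the simplices of S, computed in the affine
   charts. *)
Definition surface_measure m (S : seq 'M[R]_(m.+1, d)) (A : set pt) : \bar R :=
  (\sum_(V <- S) (area_factor V)%:E *
     leb R m (@unit_simplex m `&` chart V @^-1` A))%E.

End Simplices.

Section SurfaceMeasure.
Variables (R : realType) (d m : nat).
Implicit Types V : 'M[R]_(m.+1, d).

Lemma measurable_chart V : measurable_fun setT (chart V).
Proof.
apply/measurable_fun_rVP => k.
under eq_fun do rewrite /chart !mxE.
apply: measurable_funD => //; apply: measurable_sum => j.
by apply: measurable_funM => //; exact: measurable_coor.
Qed.

Lemma measurable_unit_simplex : measurable (@unit_simplex R m).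
Proof.
rewrite (_ : @unit_simplex R m =
  (~` \bigcup_(i in [set: 'I_m]) [set s : 'rV[R]_m | s 0 i < 0]) `&`
  ((fun s : 'rV[R]_m => \sum_i s 0 i) @^-1` `]-oo, 1])); last first.
  apply/seteqP; split => s /=.
    move=> [s0 s1]; split; last by rewrite in_itv.
    by move=> [i _ /=]; rewrite ltNge s0.
  move=> [s0]; rewrite in_itv/= => s1; split => // i.
  by rewrite leNgt; apply/negP => si; apply: s0; exists i.
apply: measurableI.
  apply: measurableC; apply: fin_bigcup_measurable => // i _.
  rewrite (_ : [set _ | _] = (fun s : 'rV[R]_m => s 0 i) @^-1` `]-oo, 0[).
    rewrite -[X in measurable X]setTI.
    by apply: measurable_coor.
  by apply/seteqP; split => s /=; rewrite in_itv.
rewrite -[X in measurable X]setTI.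
have msum : measurable_fun setT (fun s : 'rV[R]_m => \sum_i s 0 i).
  by apply: measurable_sum => i; exact: measurable_coor.
by apply: msum.
Qed.

Section Face.
Variable V : 'M[R]_(m.+1, d).

Let preimage_measurable (A : set 'rV[R]_d) : measurable A ->
  measurable (@unit_simplex R m `&` chart V @^-1` A).
Proof.
move=> mA; apply: measurableI; first exact: measurable_unit_simplex.
by have := @measurable_chart V measurableT _ mA; rewrite setTI.
Qed.

Let face (A : set 'rV[R]_d) : \bar R :=
  ((area_factor V)%:E * leb R m (@unit_simplex R m `&` chart V @^-1` A))%E.

Let face_set0 : face set0 = 0%E.
Proof. by rewrite /face preimage_set0 setI0 measure0 mule0. Qed.

Let face_ge0 A : (0 <= face A)%E.
Proof. by apply: mule_ge0 => //; rewrite lee_fin sqrtr_ge0. Qed.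

Let face_sigma_additive : semi_sigma_additive face.
Proof.
move=> F mF tF mUF; rewrite /face preimage_bigcup setI_bigcupr.
pose G k := @unit_simplex R m `&` chart V @^-1` F k.
have mG k : measurable (G k) by exact: preimage_measurable.
have tG : trivIset setT G.
  apply/trivIsetP => i j _ _ ij; rewrite setIACA -preimage_setI.
  by move/trivIsetP : tF => /(_ _ _ _ _ ij) ->//; rewrite preimage_set0 setI0.
pose r := NngNum (sqrtr_ge0 (\det (edges V *m (edges V)^T))).
apply: (@measure_semi_sigma_additive _ _ _
  [the {measure set _ -> \bar R} of mscale r (leb R m)] G) => //.
exact: bigcupT_measurable.
Qed.

HB.instance Definition _ := isMeasure.Build _ _ _ face
  face_set0 face_ge0 face_sigma_additive.

Lemma face_measure : exists nu : {measure set 'rV[R]_d -> \bar R},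
  face = nu :> (set _ -> _).
Proof. by exists [the {measure set 'rV[R]_d -> \bar R} of face]. Qed.

End Face.

Lemma surface_structure (S : seq 'M[R]_(m.+1, d)) :
  exists nu : {measure set 'rV[R]_d -> \bar R},
    surface_measure S = nu :> (set 'rV[R]_d -> \bar R).
Proof.
elim: S => [|V S [nu IH]].
  by exists mzero; apply/funext => A; rewrite /surface_measure big_nil.
have [nuV EV] := face_measure V.
exists (measure_add nuV nu); apply/funext => A.
have -> : surface_measure (V :: S) A = (nuV A + nu A)%E.
  by rewrite -IH -EV /surface_measure big_cons.
by rewrite -measure_addE.
Qed.

Variable S : seq 'M[R]_(m.+1, d).

Let surface_set0 : surface_measure S set0 = 0%E.
Proof. by have [nu ->] := surface_structure S; rewrite measure0. Qed.

Let surface_ge0 A : (0 <= surface_measure S A)%E.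
Proof. by have [nu ->] := surface_structure S; exact: measure_ge0. Qed.

Let surface_sigma_additive : semi_sigma_additive (surface_measure S).
Proof.
by have [nu ->] := surface_structure S; exact: measure_semi_sigma_additive.
Qed.

HB.instance Definition _ := isMeasure.Build _ _ _ (surface_measure S)
  surface_set0 surface_ge0 surface_sigma_additive.

End SurfaceMeasure.

Section SquareIntegrable.
Context {disp : measure_display} {T : measurableType disp} {R : realType}.
Variables (mu : {measure set T -> \bar R}) (A : set T).

Definition L2 (f : T -> R) : Prop :=
  measurable_fun A f /\ (\int[mu]_(x in A) ((f x) ^+ 2)%:E < +oo)%E.

Definition ip (f g : T -> R) : R := \int[mu]_(x in A) (f x * g x).

Definition normL2 (f : T -> R) : R := Num.sqrt (ip f f).

(* f is in C([0, tmax]; L^2(A)). *)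
Definition CL2 (tmax : R) (f : R -> T -> R) : Prop :=
  (forall t, 0 <= t <= tmax -> L2 (f t)) /\
  (forall t, 0 <= t <= tmax -> forall e : R, 0 < e ->
     \forall s \near t, 0 <= s <= tmax -> normL2 (f s - f t) < e).

End SquareIntegrable.

Section Sobolev.
Variables (R : realType) (d : nat).
Local Notation pt := 'rV[R]_d.
Implicit Types Om Gam : set pt.

Definition partial (i : 'I_d) (f : pt -> R) : pt -> R :=
  fun x => 'D_(delta_mx 0 i) f x.

Definition smooth (f : pt -> R) : Prop :=
  forall s : seq 'I_d, continuous (foldr partial f s) /\
    forall i x, derivable (foldr partial f s) x (delta_mx 0 i).

Definition test_function Om (phi : pt -> R) : Prop :=
  smooth phi /\
  exists K : set pt, [/\ compact K, K `<=` Om & forall x, ~ K x -> phi x = 0].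

Definition weak_partial Om (i : 'I_d) (v g : pt -> R) : Prop :=
  forall phi, test_function Om phi ->
    \int[leb R d]_(x in Om) (v x * partial i phi x) =
    - \int[leb R d]_(x in Om) (g x * phi x).

(* A weakly differentiable function is carried together with its weak gradient,
   which it determines up to null sets: for v : wdiff, v.1 is the function and
   v.2 i is its i-th weak partial derivative once v is in H1. *)
Definition wdiff : Type := ((pt -> R) * ('I_d -> pt -> R))%type.

Definition H1 Om (v : wdiff) : Prop :=
  L2 (leb R d) Om v.1 /\
  forall i, L2 (leb R d) Om (v.2 i) /\ weak_partial Om i v.1 (v.2 i).

Definition norm_grad Om (v : wdiff) : R :=
  Num.sqrt (\int[leb R d]_(x in Om) (\sum_i v.2 i x ^+ 2)).

Definition normH1 Om (v : wdiff) : R :=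
  Num.sqrt (normL2 (leb R d) Om v.1 ^+ 2 + norm_grad Om v ^+ 2).

Definition of_smooth (w : pt -> R) : wdiff := (w, fun i => partial i w).

(* v = 0 on Gam in the sense of traces: the trace of v is the limit in
   L^2(Gam; sigma) of the restrictions of smooth functions converging to v in
   H^1(Om). *)
Definition zero_trace Om (sigma : {measure set pt -> \bar R}) Gam
    (v : wdiff) : Prop :=
  exists w : nat -> pt -> R,
    [/\ forall n, [/\ smooth (w n), H1 Om (of_smooth (w n)) &
                      L2 sigma Gam (w n)],
        normH1 Om (v - of_smooth (w n)) @[n --> \oo] --> 0 &
        normL2 sigma Gam (w n) @[n --> \oo] --> 0].

Definition H10 Om (sigma : {measure set pt -> \bar R}) Gam (v : wdiff) : Prop :=
  H1 Om v /\ zero_trace Om sigma Gam v.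

Definition wvec : Type := 'I_d -> wdiff.

Definition normH1v Om (v : wvec) : R :=
  Num.sqrt (\sum_j normH1 Om (v j) ^+ 2).

Definition strain (v : wvec) (i j : 'I_d) (x : pt) : R :=
  2^-1 * ((v i).2 j x + (v j).2 i x).

Definition divergence (v : wvec) (x : pt) : R := \sum_i (v i).2 i x.

Definition norm_strain Om (v : wvec) : R :=
  Num.sqrt (\int[leb R d]_(x in Om) (\sum_i \sum_j strain v i j x ^+ 2)).

(* The restriction of v to each simplex of Th is a polynomial of total degree
   at most k. *)
Definition piecewise_poly (k : nat) (Th : seq 'M[R]_(d.+1, d))
    (v : pt -> R) : Prop :=
  forall E, E \in Th -> exists p : mpoly.mpoly d R,
    (forall m, m \in mpoly.msupp p -> (mpoly.mdeg m <= k)%N) /\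
    (forall x, simplex E x -> v x = mpoly.meval (fun i => x 0 i) p).

End Sobolev.

Section Biot.
Variables (R : realType) (d : nat).
Local Notation pt := 'rV[R]_d.

Record biot := Biot {
  Om : set pt;
  faces : seq 'M[R]_(d.-1.+1, d);
  Gu : set pt;
  Gs : set pt;
  Gp : set pt;
  Gq : set pt;
  lam : R;
  mu : R;
  alpha : R;
  kp : R;
  c0 : R }.

Definition bdry (A : set pt) : set pt := closure A `\` A°.

(* F lists flat (d-1)-simplices that tile the boundary; the surface measure on
   the boundary is the area they carry, whatever the tiling. *)
Definition polyhedral_domain (A : set pt)
    (F : seq 'M[R]_(d.-1.+1, d)) : Prop :=
  [/\ open A, connected A, bounded_set A, (closure A)° = A &
      triangulates F (bdry A)].

Definition boundary_split (B : biot) (G1 G2 : set pt) : Prop :=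
  [/\ bdry (Om B) = G1 `|` G2, G1 `&` G2 = set0,
      measurable G1, measurable G2 & (0 < surface_measure (faces B) G1)%E].

Definition admissible (B : biot) : Prop :=
  [/\ polyhedral_domain (Om B) (faces B),
      boundary_split B (Gu B) (Gs B),
      boundary_split B (Gp B) (Gq B),
      [/\ 0 < lam B, 0 < mu B, 0 < alpha B & 0 < kp B] &
      0 <= c0 B].

Record data := Data {
  body : R -> 'I_d -> pt -> R;
  traction : R -> 'I_d -> pt -> R;
  source : R -> pt -> R;
  flux : R -> pt -> R }.

Variable B : biot.
Local Notation vol := (leb R d).
Local Notation sigma := (surface_measure (faces B)).

Definition regular_data (tmax : R) (D : data) : Prop :=
  [/\ forall j, CL2 vol (Om B) tmax (fun t => body D t j),
      forall j, CL2 sigma (Gs B) tmax (fun t => traction D t j),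
      CL2 vol (Om B) tmax (source D) &
      CL2 sigma (Gq B) tmax (flux D)].

Definition korn : Prop :=
  exists CK : R, forall v : wvec R d,
    (forall j, H10 (Om B) sigma (Gu B) (v j)) ->
    normH1v (Om B) v <= CK * norm_strain (Om B) v.

Definition poincare : Prop :=
  exists CP : R, forall psi : wdiff R d, H10 (Om B) sigma (Gp B) psi ->
    normL2 vol (Om B) psi.1 <= CP * norm_grad (Om B) psi.

Definition form_a1 (u v : wvec R d) : R :=
  2 * mu B *
  \int[vol]_(x in Om B) (\sum_i \sum_j strain u i j x * strain v i j x).

Definition form_b (v : wvec R d) (phi : pt -> R) : R :=
  \int[vol]_(x in Om B) (phi x * divergence v x).

Definition form_a2 (xi phi : pt -> R) : R :=
  (lam B)^-1 * ip vol (Om B) xi phi.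

Definition form_c (p phi : pt -> R) : R :=
  alpha B / lam B * ip vol (Om B) p phi.

Definition form_a3 (p psi : pt -> R) : R :=
  (c0 B + alpha B ^+ 2 / lam B) * ip vol (Om B) p psi.

Definition form_d (p psi : wdiff R d) : R :=
  kp B * \int[vol]_(x in Om B) (\sum_i p.2 i x * psi.2 i x).

Definition load_u (D : data) (t : R) (v : wvec R d) : R :=
  \int[vol]_(x in Om B) (\sum_j body D t j x * (v j).1 x) +
  \int[sigma]_(x in Gs B) (\sum_j traction D t j x * (v j).1 x).

Definition load_p (D : data) (s t : R) (psi : wdiff R d) : R :=
  2^-1 * ip vol (Om B) (source D t + source D s) psi.1 +
  2^-1 * ip sigma (Gq B) (flux D t + flux D s) psi.1.

Variables (k l : nat) (Th : seq 'M[R]_(d.+1, d)).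

Definition Vh (v : wvec R d) : Prop :=
  forall j, [/\ H10 (Om B) sigma (Gu B) (v j),
                {within closure (Om B), continuous (v j).1} &
                piecewise_poly k Th (v j).1].

Definition Wh (phi : pt -> R) : Prop :=
  [/\ L2 vol (Om B) phi,
      {within closure (Om B), continuous phi} &
      piecewise_poly k.-1 Th phi].

Definition Mh (psi : wdiff R d) : Prop :=
  [/\ H10 (Om B) sigma (Gp B) psi,
      {within closure (Om B), continuous psi.1} &
      piecewise_poly l Th psi.1].

Definition inf_sup (beta : R) : Prop :=
  forall phi, Wh phi ->
    ((beta * normL2 vol (Om B) phi)%:E <=
     ereal_sup [set (form_b v phi / normH1v (Om B) v)%:E |
                v in [set v | Vh v /\ normH1v (Om B) v != 0%R]])%E.

Definition elasticity_step (D : data) (t : R) (u : wvec R d)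
    (xi p : pt -> R) : Prop :=
  (forall v, Vh v -> form_a1 u v - form_b v xi = load_u D t v) /\
  (forall phi, Wh phi -> form_b u phi + form_a2 xi phi = form_c p phi).

Definition pressure_step (D : data) (dt : R) (n : nat)
    (p p' : wdiff R d) (xi xi' : pt -> R) : Prop :=
  forall psi, Mh psi ->
    form_a3 (dt^-1 *: (p.1 - p'.1)) psi.1
    - form_c psi.1 (dt^-1 *: (xi - xi'))
    + form_d (2^-1 *: (p + p')) psi
    = load_p D (n.-1%:R * dt) (n%:R * dt) psi.

Definition coupled_solution (D : data) (dt : R) (N : nat)
    (u : nat -> wvec R d) (xi : nat -> pt -> R) (p : nat -> wdiff R d) : Prop :=
  (forall n, (n <= N)%N -> [/\ Vh (u n), Wh (xi n) & Mh (p n)]) /\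
  forall n, (0 < n <= N)%N ->
    [/\ forall v, Vh v ->
          form_a1 (u n) v - form_b v (xi n) = load_u D (n%:R * dt) v,
        forall phi, Wh phi ->
          form_b (u n) phi + form_a2 (xi n) phi - form_c (p n).1 phi = 0 &
        pressure_step D dt n (p n) (p n.-1) (xi n) (xi n.-1)].

(* The first index is the iteration i, the second one the time level n. *)
Definition decoupled_iterates (D : data) (dt : R) (N : nat)
    (u0 : wvec R d) (xi0 : pt -> R) (p0 : wdiff R d)
    (u : nat -> nat -> wvec R d) (xi : nat -> nat -> pt -> R)
    (p : nat -> nat -> wdiff R d) : Prop :=
  [/\ forall n, (n <= N)%N -> [/\ u 0 n = u0, xi 0 n = xi0 & p 0 n = p0],
      forall i, (0 < i)%N -> [/\ u i 0 = u0, xi i 0 = xi0 & p i 0 = p0],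
      forall i n, (0 < i)%N -> (0 < n <= N)%N ->
        Mh (p i n) /\
        pressure_step D dt n (p i n) (p i n.-1) (xi i.-1 n) (xi i.-1 n.-1) &
      forall i n, (0 < i)%N -> (0 < n <= N)%N ->
        [/\ Vh (u i n), Wh (xi i n) &
            elasticity_step D (n%:R * dt) (u i n) (xi i n) (p i n).1]].

End Biot.

(* Main.v *)
Require Import Defs.
From mathcomp Require Import all_boot all_order all_algebra.
From mathcomp Require Import all_classical all_reals all_analysis.
From mathcomp Require Import measurable_realfun.
From mathcomp Require Import ring lra.
From mathcomp Require mpoly.
Import (canonicals, coercions) mpoly.
Import Order.TTheory GRing.Theory Num.Theory.
Import numFieldNormedType.Exports.
Local Open Scope classical_set_scope.
Local Open Scope ring_scope.

Set Implicit Arguments.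
Unset Strict Implicit.
Unset Printing Implicit Defensive.

(** The errors between the decoupled iterates and the coupled solution solve the
    same equations with zero data, since both schemes have the same loads.
    Write e_u, e_xi, e_p for these errors and d for the increment from time
    level n-1 to n; C = beta^2/(2 mu) and A = c_0 + alpha^2/lambda.

    Elasticity step.  Testing the homogeneous saddle-point problem with its own
    solution gives
      2 mu |eps(e_u)|^2 + |e_xi|^2/lambda = (alpha/lambda) (e_p, e_xi),
    and the inf-sup condition gives beta |e_xi| <= 2 mu |eps(e_u)|, so that
    (C lambda + 1) |e_xi| <= alpha |e_p| ([multiplier_le_pressure]).  The
    problem is linear and has no coupling between time levels, so the same
    inequality holds for the increments.

    Pressure step.  Testing with d e_p makes the diffusion term telescope, and
    Young's inequality absorbs the coupling term:
      A sum |d e_p^i|^2 + dt k_p |grad e_p^(N,i)|^2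
        <= alpha^2/(lambda^2 A) sum |d e_xi^(i-1)|^2     ([pressure_energy]).
    Dropping the gradient and combining with the elasticity estimate contracts
    the sum of squared increments by L_g^2, hence by L_g < 1 ([contraction]).
    Dropping the increments instead bounds the pressure error at the last time
    by Poincare's inequality ([pressure_bound]); the inf-sup condition and
    Korn's inequality then bound the other two errors.

    None of the constants depends on N, and truncating both schemes at a time
    level n <= N leaves them of the same kind, so convergence at level n is the
    final-time estimate for n steps together with geometric decay.

    Two things have to be provided for this argument: the bilinear forms really
    are bilinear, because the L^2 products are finite, and the errors belong to
    the discrete spaces, in particular the space of H^1 functions with zero
    trace is closed under subtraction ([H10B]).  The latter uses Minkowski's
    inequality for the traces, and, for weak derivatives, that test functions
    are square integrable over a bounded open set. *)

(** * Lebesgue measure of open and bounded sets of row vectors *)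

(** An open set is the countable union of the boxes with rational centre and
    rational radius that it contains, and boxes are measurable for the
    sigma-algebra generated by the coordinates. *)
Lemma open_measurable_rV (R : realType) (n : nat) (A : set 'rV[R]_n) :
  open A -> measurable A.
Proof.
move=> oA.
pose box (qe : 'rV[rat]_n * rat) : set 'rV[R]_n :=
  [set x | forall j, x 0 j \in `]ratr (qe.1 0 j) - ratr qe.2,
                                  ratr (qe.1 0 j) + ratr qe.2[].
pose Q : set ('rV[rat]_n * rat) := [set qe | box qe `<=` A].
have mbox qe : measurable (box qe).
  have -> : box qe = \bigcap_(j in [set: 'I_n]) ((fun x : 'rV[R]_n => x 0 j)
      @^-1` `]ratr (qe.1 0 j) - ratr qe.2, ratr (qe.1 0 j) + ratr qe.2[).
    by apply/seteqP; split => [x bx j _|x bx j]; [exact: bx | exact: bx].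
  apply: fin_bigcap_measurable => // j _.
  rewrite -[X in measurable X]setTI; exact: measurable_coor.
have -> : A = \bigcup_(qe in Q) box qe.
  apply/seteqP; split => [x Ax|x [qe Qqe bx]]; last exact: Qqe.
  have /nbhs_ballP [e /= e0 eA] := open_nbhs_nbhs (conj oA Ax).
  (* The centre may be off by r from x, hence radius r and r < e / 2. *)
  have [r] := @rat_in_itvoo R 0 (e / 2) ltac:(by rewrite divr_gt0).
  rewrite in_itv/= => /andP[r0 re].
  have P j : exists q : rat, ratr q \in `]x 0 j - ratr r, x 0 j + ratr r[.
    by apply: rat_in_itvoo; lra.
  have [q qP] := choice P.
  exists (\row_j q j, r).
    move=> y by_; apply: eA; split => // i j; rewrite (ord1 i).
    rewrite -ball_normE /=.
    have := by_ j; have := qP j; rewrite !in_itv/= !mxE ltr_norml.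
    lra.
  by move=> j /=; have := qP j; rewrite !in_itv/= !mxE; lra.
rewrite bigcup_mkcond; apply: countable_bigcupT_measurable => [|qe].
  exact: countableP.
by case: ifP.
Qed.

Lemma continuous_measurable_rV (R : realType) (n : nat) (f : 'rV[R]_n -> R) :
  continuous f -> measurable_fun setT f.
Proof.
move=> cf; apply: (measurability _ (@RGenOpens.measurableE R)) => //.
move=> _ [_ [a [b ->] <-]]; rewrite setTI; apply: open_measurable_rV.
by move/continuousP : cf; apply; exact: interval_open.
Qed.

Lemma mx_entry_le_norm (R : realType) (n : nat) (x : 'rV[R]_n) (j : 'I_n) :
  `|x 0 j| <= `|x|.
Proof.
have /mapP[k Hk ->] : `|x 0 j| \in [seq `|x y.1 y.2| | y : 'I_1 * 'I_n].
  by apply/mapP; exists (0, j) => //=; rewrite mem_enum.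
rewrite [leRHS]/Num.Def.normr /= mx_normrE; apply/bigmax_geP; right => /=.
by exists k.
Qed.

Definition cube (R : realType) (n : nat) (M : R) : set 'rV[R]_n :=
  [set x | forall j, x 0 j \in `[- M, M]].
Arguments cube {R} n M.

Lemma measurable_cube (R : realType) (n : nat) (M : R) :
  measurable (cube n M).
Proof.
have -> : cube n M =
    \bigcap_(j in [set: 'I_n]) ((fun x : 'rV[R]_n => x 0 j) @^-1` `[- M, M]).
  by apply/seteqP; split => [x bx j _|x bx j]; [exact: bx | exact: bx].
apply: fin_bigcap_measurable => // j _.
by rewrite -[X in measurable X]setTI; exact: measurable_coor.
Qed.

Lemma leb_cube_fin (R : realType) (n : nat) (M : R) :
  (leb R n (cube n M) < +oo)%E.
Proof.
elim: n => [|n IH] /=.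
  by rewrite diracE; case: (_ \in _); rewrite ltry.
rewrite /pushforward (_ : _ @^-1` _ = `[- M, M]%classic `*` cube n M).
  rewrite (product_measure1E _ (leb R n)) //; last exact: measurable_cube.
  rewrite lte_mul_pinfty//.
  suff fin : (@lebesgue_measure R [set` (`[- M, M])%R] < +oo)%E.
    by rewrite ge0_fin_numE//; exact: fin.
  by rewrite lebesgue_measure_itv; case: ifP => // _; rewrite ltry.
apply/seteqP; split => [z zP|z [z1 z2] j]; last first.
  rewrite /rV_cons mxE; case: unliftP => [k _|_]; [exact: z2 | exact: z1].
split=> [|j].
  by have := zP ord0; rewrite /rV_cons mxE unlift_none.
by have := zP (lift ord0 j); rewrite /rV_cons mxE liftK.
Qed.

Lemma compact_cube (R : realType) (n : nat) (M : R) : compact (cube n M).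
Proof.
have -> : cube n M = [set v : 'rV[R]_n | forall i, `[- M, M]%classic (v ord0 i)].
  by apply/seteqP; split => x /= xP j; [exact: xP | exact: xP].
apply: (@rV_compact _ _ (fun=> `[- M, M]%classic)) => _.
exact: segment_compact.
Qed.

Lemma bounded_sub_cube (R : realType) (n : nat) (A : set 'rV[R]_n) :
  bounded_set A -> exists M, A `<=` cube n M.
Proof.
move=> [M [_ AM]]; exists (M + 1) => x Ax j.
rewrite in_itv/= -ler_norml; apply: (le_trans (mx_entry_le_norm x j)).
by apply: AM => //; rewrite ltrDl.
Qed.

Lemma leb_bounded_fin (R : realType) (n : nat) (A : set 'rV[R]_n) :
  measurable A -> bounded_set A -> (leb R n A < +oo)%E.
Proof.
move=> mA /bounded_sub_cube[M AM]; apply: le_lt_trans (leb_cube_fin n M).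
by apply: le_measure; rewrite ?inE//; exact: measurable_cube.
Qed.

(** * Semi-inner products on a subspace *)

Section SemiInnerProduct.
Variable R : realType.

(** Linearity is required on the subspace [P] only: the integral of a product is
    additive for square-integrable factors, while it takes a default value when
    the product is not integrable. *)
Record semi_inner (V : lmodType R) (P : V -> Prop) (a : V -> V -> R) : Prop :=
  SemiInner {
    semi_innerP : forall c u v, P u -> P v -> P (c *: u + v);
    semi_inner_lin : forall c u v w, P u -> P v -> P w ->
      a (c *: u + v) w = c * a u w + a v w;
    semi_inner_sym : forall u v, a u v = a v u;
    semi_inner_ge0 : forall u, 0 <= a u u }.

Section Theory.
Variables (V : lmodType R) (P : V -> Prop) (a : V -> V -> R).
Hypothesis aP : semi_inner P a.
Local Notation "`[ u ]" := (Num.sqrt (a u u)) (format "`[ u ]").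

Lemma semi_inner_closedB u v : P u -> P v -> P (u - v).
Proof.
by move=> Pu Pv; rewrite addrC -scaleN1r; exact: semi_innerP aP _ _ _ Pv Pu.
Qed.

Lemma semi_inner_closed0 u : P u -> P 0.
Proof. by move=> Pu; rewrite -(subrr u); exact: semi_inner_closedB. Qed.

Lemma semi_inner_closedZ c u : P u -> P (c *: u).
Proof.
move=> Pu; rewrite -[_ *: _]addr0.
by apply: (semi_innerP aP) => //; exact: semi_inner_closed0 Pu.
Qed.

Lemma semi_inner_closedD u v : P u -> P v -> P (u + v).
Proof.
by move=> Pu Pv; rewrite -[u]scale1r; exact: semi_innerP aP _ _ _ Pu Pv.
Qed.

Lemma semi_innerDl u v w : P u -> P v -> P w -> a (u + v) w = a u w + a v w.
Proof.
by move=> Pu Pv Pw; rewrite -[u in LHS]scale1r (semi_inner_lin aP)// mul1r.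
Qed.

Lemma semi_innerBl u v w : P u -> P v -> P w -> a (u - v) w = a u w - a v w.
Proof.
move=> Pu Pv Pw; rewrite addrC -scaleN1r (semi_inner_lin aP)//.
by rewrite mulN1r addrC.
Qed.

Lemma semi_innerZl c u w : P u -> P w -> a (c *: u) w = c * a u w.
Proof.
move=> Pu Pw; have P0 := semi_inner_closed0 Pu.
have := semi_innerBl Pu Pu Pw; rewrite !subrr => a0.
by rewrite -[_ *: _]addr0 (semi_inner_lin aP)// a0 addr0.
Qed.

Lemma semi_innerBr u v w : P u -> P v -> P w -> a w (u - v) = a w u - a w v.
Proof.
by move=> *; rewrite !(semi_inner_sym aP w); exact: semi_innerBl.
Qed.

Lemma semi_innerDr u v w : P u -> P v -> P w -> a w (u + v) = a w u + a w v.
Proof.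
by move=> *; rewrite !(semi_inner_sym aP w); exact: semi_innerDl.
Qed.

Lemma semi_innerZr c u w : P u -> P w -> a w (c *: u) = c * a w u.
Proof.
by move=> *; rewrite !(semi_inner_sym aP w); exact: semi_innerZl.
Qed.

Lemma sqr_seminorm u : `[u] ^+ 2 = a u u.
Proof. by rewrite sqr_sqrtr// (semi_inner_ge0 aP). Qed.

Lemma semi_inner_expand t u v : P u -> P v ->
  a (t *: u + v) (t *: u + v) = t ^+ 2 * a u u + 2 * t * a u v + a v v.
Proof.
move=> Pu Pv; have Pw := semi_innerP aP t Pu Pv.
rewrite (semi_inner_lin aP)// (semi_inner_sym aP u) (semi_inner_sym aP v).
rewrite !(semi_inner_lin aP)// (semi_inner_sym aP v u); ring.
Qed.

(** The form is nonnegative along the line t *: u + v, so its discriminant in t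
    is nonpositive. *)
Lemma cauchy_schwarz u v : P u -> P v -> `|a u v| <= `[u] * `[v].
Proof.
move=> Pu Pv; have u0 := semi_inner_ge0 aP u; have v0 := semi_inner_ge0 aP v.
rewrite -sqrtrM// -sqrtr_sqr; apply: ler_wsqrtr.
have pos t : 0 <= t ^+ 2 * a u u + 2 * t * a u v + a v v.
  by rewrite -semi_inner_expand//; exact: semi_inner_ge0 aP _.
have [u00|u00] := eqVneq (a u u) 0.
  have [->|uv0] := eqVneq (a u v) 0; first by rewrite expr0n/= mulr_ge0.
  (* The quadratic is affine in t; at this t it would equal -1. *)
  have := pos (- (a v v + 1) / (2 * a u v)); rewrite u00.
  suff -> : 2 * (- (a v v + 1) / (2 * a u v)) * a u v = - (a v v + 1).
    by rewrite mulr0; lra.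
  by field; rewrite uv0.
(* The minimum of the quadratic. *)
have := pos (- a u v / a u u).
suff -> : (- a u v / a u u) ^+ 2 * a u u + 2 * (- a u v / a u u) * a u v
    + a v v = (a u u * a v v - a u v ^+ 2) / a u u.
  by rewrite pmulr_lge0 ?subr_ge0// invr_gt0 lt_neqAle eq_sym u00.
by field.
Qed.

Lemma minkowski u v : P u -> P v -> `[u + v] <= `[u] + `[v].
Proof.
move=> Pu Pv; rewrite -[leRHS]ger0_norm ?addr_ge0 ?sqrtr_ge0//.
rewrite -sqrtr_sqr; apply: ler_wsqrtr.
have := semi_inner_expand 1 Pu Pv; rewrite scale1r => ->.
have := le_trans (ler_norm _) (cauchy_schwarz Pu Pv).
by rewrite sqrrD !sqr_seminorm; lra.
Qed.

Lemma seminormN u : P u -> `[- u] = `[u].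
Proof.
move=> Pu; rewrite -scaleN1r semi_innerZl ?semi_innerZr//.
  by rewrite !mulN1r opprK.
exact: semi_inner_closedZ.
Qed.

Lemma minkowskiB u v : P u -> P v -> `[u - v] <= `[u] + `[v].
Proof.
move=> Pu Pv; rewrite -(seminormN Pv); apply: minkowski => //.
by rewrite -scaleN1r; exact: semi_inner_closedZ.
Qed.

End Theory.

Lemma semi_inner_comp (V W : lmodType R) (L : V -> W)
    (P : W -> Prop) (a : W -> W -> R) : linear L -> semi_inner P a ->
  semi_inner (fun u => P (L u)) (fun u v => a (L u) (L v)).
Proof.
move=> linL aP; split => [c u v Pu Pv|c u v w Pu Pv Pw|u v|u].
- by rewrite linL; exact: semi_innerP aP _ _ _ Pu Pv.
- by rewrite linL (semi_inner_lin aP).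
- exact: semi_inner_sym aP _ _.
- exact: semi_inner_ge0 aP _.
Qed.

Lemma semi_inner_sum (I : finType) (V : lmodType R) (P : I -> V -> Prop)
    (a : I -> V -> V -> R) : (forall i, semi_inner (P i) (a i)) ->
  semi_inner (fun u => forall i, P i u) (fun u v => \sum_i a i u v).
Proof.
move=> aP; split => [c u v Pu Pv i|c u v w Pu Pv Pw|u v|u].
- exact: semi_innerP (aP i) _ _ _ (Pu i) (Pv i).
- rewrite mulr_sumr -big_split /=; apply: eq_bigr => i _.
  exact: semi_inner_lin (aP i) _ _ _ _ (Pu i) (Pv i) (Pw i).
- by apply: eq_bigr => i _; exact: semi_inner_sym (aP i) _ _.
- by apply: sumr_ge0 => i _; exact: semi_inner_ge0 (aP i) _.
Qed.

Lemma semi_inner_add (V : lmodType R) (P Q : V -> Prop) (a b : V -> V -> R) :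
  semi_inner P a -> semi_inner Q b ->
  semi_inner (fun u => P u /\ Q u) (fun u v => a u v + b u v).
Proof.
move=> aP bQ; split => [c u v [Pu Qu] [Pv Qv]|c u v w [Pu Qu] [Pv Qv] [Pw Qw]|
  u v|u].
- by split; [exact: semi_innerP aP _ _ _ Pu Pv|exact: semi_innerP bQ _ _ _ Qu Qv].
- by rewrite (semi_inner_lin aP)// (semi_inner_lin bQ)//; ring.
- by rewrite (semi_inner_sym aP) (semi_inner_sym bQ).
- by rewrite addr_ge0 ?(semi_inner_ge0 aP) ?(semi_inner_ge0 bQ).
Qed.

End SemiInnerProduct.

(** * Square-integrable functions *)

Section SquareIntegrableTheory.
Context {disp : measure_display} {T : measurableType disp} {R : realType}.
Variables (mu : {measure set T -> \bar R}) (A : set T).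
Hypothesis mA : measurable A.

Local Notation L2 := (L2 mu A).
Local Notation ip := (ip mu A).

Lemma L2P (f : T -> R) : L2 f <->
  measurable_fun A f /\ mu.-integrable A (EFin \o (fun x => f x ^+ 2)).
Proof.
have E : (\int[mu]_(x in A) `|(EFin \o (fun x => (f x ^+ 2)%R)) x| =
    \int[mu]_(x in A) (f x ^+ 2)%:E)%E.
  by apply: eq_integral => x _ /=; rewrite ger0_norm ?sqr_ge0.
split=> -[mf]; last by move=> /integrableP[_]; rewrite E; split.
move=> ff; split=> //; apply/integrableP; rewrite E; split=> //.
by apply/measurable_EFinP; exact: measurable_funX.
Qed.

Lemma L2_integrable_prod (f g : T -> R) :
  L2 f -> L2 g -> mu.-integrable A (EFin \o (fun x => f x * g x)).
Proof.
move=> Lf Lg.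
have /L2P[mf If] := Lf; have /L2P[mg Ig] := Lg.
apply: (le_integrable mA _ _ (integrableD mA If Ig)).
  by apply/measurable_EFinP; apply: measurable_funM.
move=> x _ /=; rewrite lee_fin normrM (ger0_norm (addr_ge0 _ _)) ?sqr_ge0//.
rewrite -(normr_id (f x)) -(normr_id (g x)).
rewrite -(real_normK (num_real (f x))) -(real_normK (num_real (g x))).
have := sqr_ge0 (`|f x| - `|g x|); rewrite !normr_id sqrrB.
have := sqr_ge0 (`|f x|); have := sqr_ge0 (`|g x|); nra.
Qed.

Lemma ip_semi_inner : semi_inner L2 ip.
Proof.
split => [c f g Lf Lg|c f g h Lf Lg Lh|f g|f].
- have /L2P[mf If] := Lf; have /L2P[mg Ig] := Lg.
  have mh : measurable_fun A (c *: f + g).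
    by apply: measurable_funD => //; exact: measurable_funM.
  apply/L2P; split=> //.
  apply: (le_integrable mA _ _ (integrableD mA
    (integrableZl mA (2 * c ^+ 2) If) (integrableZl mA 2 Ig))).
    by apply/measurable_EFinP; exact: measurable_funX.
  move=> x _; rewrite /= lee_fin !ger0_norm ?sqr_ge0//.
    have := sqr_ge0 (c * f x - g x); rewrite -[(c *: f + g) x]/(c * f x + g x).
    by rewrite sqrrB sqrrD exprMn; lra.
  by apply: addr_ge0; apply: mulr_ge0; rewrite ?sqr_ge0 // mulr_ge0 ?sqr_ge0.
- rewrite /Defs.ip -RintegralZl//; last exact: L2_integrable_prod.
  rewrite -RintegralD//; last 2 first.
    by apply: (integrableZl mA c (L2_integrable_prod Lf Lh)).
  exact: L2_integrable_prod.
  by apply: eq_Rintegral => x _ /=; rewrite mulrDl mulrA.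
- by apply: eq_Rintegral => x _; rewrite mulrC.
- by apply: Rintegral_ge0 => x _; exact: sqr_ge0.
Qed.

End SquareIntegrableTheory.

Lemma Rintegral_sum_prod (disp : measure_display) (T : measurableType disp)
    (R : realType) (mu : {measure set T -> \bar R}) (A : set T)
    (I : finType) (f g : I -> T -> R) : measurable A ->
  (forall i, L2 mu A (f i)) -> (forall i, L2 mu A (g i)) ->
  \int[mu]_(x in A) (\sum_i f i x * g i x) = \sum_i ip mu A (f i) (g i).
Proof.
move=> mA Lf Lg.
have Ifg i : mu.-integrable A (EFin \o (fun x => f i x * g i x)).
  exact: L2_integrable_prod.
elim: (index_enum I) => [|i r IH].
  under eq_Rintegral do rewrite big_nil.
  by rewrite big_nil Rintegral_cst// mul0r.
under eq_Rintegral do rewrite big_cons.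
rewrite big_cons RintegralD//; first by rewrite IH.
rewrite (_ : _ \o _ = fun x => (\sum_(j <- r) (f j x * g j x)%:E)%E); last first.
  by apply/funext => x /=; rewrite sumEFin.
by apply: integrable_sum => // i' _; exact: Ifg.
Qed.

(** * Weakly differentiable functions and zero traces *)

Section SobolevTheory.
Variables (R : realType) (d : nat) (Om : set 'rV[R]_d).
Hypothesis mOm : measurable Om.
Hypothesis bOm : bounded_set Om.
Local Notation pt := 'rV[R]_d.
Local Notation vol := (leb R d).
Local Notation L2 := (L2 vol Om).
Local Notation ip := (ip vol Om).

(** A continuous function is bounded on a cube containing the bounded set, which
    has finite measure. *)
Lemma continuous_L2 (f : pt -> R) : continuous f -> L2 f.
Proof.
move=> cf; have mf : measurable_fun Om f.
  exact: measurable_funS (continuous_measurable_rV cf).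
apply/L2P; split=> //; apply: measurable_bounded_integrable => //.
- exact: leb_bounded_fin.
- exact: measurable_funX.
have [M OmM] := bounded_sub_cube bOm.
have : bounded_set ((fun x => f x ^+ 2) @` cube d M).
  apply: compact_bounded; apply: continuous_compact (@compact_cube R d M).
  apply: continuous_subspaceT => x.
  apply: (@continuous_comp _ _ _ f (fun y : R => y ^+ 2) x (cf x)).
  exact: exprn_continuous.
move=> [N [Nr fN]]; exists N; split=> // K NK x Omx /=.
by apply: (fN K NK); exists x => //; exact: OmM.
Qed.

Lemma partialB i (f g : pt -> R) :
  (forall x, derivable f x (delta_mx 0 i)) ->
  (forall x, derivable g x (delta_mx 0 i)) ->
  partial i (f - g) = partial i f - partial i g.
Proof. by move=> df dg; apply/funext => x; exact: deriveB. Qed.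

Lemma foldr_partialB (f g : pt -> R) s : smooth f -> smooth g ->
  foldr (@partial R d) (f - g) s =
  foldr (@partial R d) f s - foldr (@partial R d) g s.
Proof.
move=> sf sg; elim: s => [//|i s IH] /=.
by rewrite IH partialB//; [case: (sf s) | case: (sg s)].
Qed.

Lemma smoothB (f g : pt -> R) : smooth f -> smooth g -> smooth (f - g).
Proof.
move=> sf sg s; rewrite foldr_partialB//.
have [cf df] := sf s; have [cg dg] := sg s; split=> [x|i x].
  exact: (continuousB (cf x) (cg x)).
exact: (derivableB (df i x) (dg i x)).
Qed.

Lemma of_smoothB (f g : pt -> R) : smooth f -> smooth g ->
  of_smooth (f - g) = of_smooth f - of_smooth g.
Proof.
move=> sf sg; congr pair; apply/funext => i; apply: partialB.
  by case: (sf [::]). by case: (sg [::]).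
Qed.

(** Test functions and their derivatives are square integrable, so both sides of
    the defining identity are inner products, linear in [v] and [g]. *)
Lemma weak_partialB i (v v' g g' : pt -> R) :
  L2 v -> L2 v' -> L2 g -> L2 g' ->
  weak_partial Om i v g -> weak_partial Om i v' g' ->
  weak_partial Om i (v - v') (g - g').
Proof.
move=> Lv Lv' Lg Lg' vg vg' phi tphi; have [sphi _] := tphi.
have Lphi : L2 phi by apply: continuous_L2; case: (sphi [::]).
have Ldphi : L2 (partial i phi) by apply: continuous_L2; case: (sphi [:: i]).
have ipP := ip_semi_inner vol mOm.
rewrite -[LHS]/(ip _ _) -[X in _ = - X]/(ip _ _) !(semi_innerBl ipP)//.
rewrite -[ip v _]/(Rintegral _ _ _) vg// -[ip v' _]/(Rintegral _ _ _) vg'//.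
by rewrite opprB addrC opprK.
Qed.

Lemma H1B (v w : wdiff R d) : H1 Om v -> H1 Om w -> H1 Om (v - w).
Proof.
move=> [Lv dv] [Lw dw]; have ipP := ip_semi_inner vol mOm.
split=> [|i]; first exact: (semi_inner_closedB ipP Lv Lw).
have [Lvi vi] := dv i; have [Lwi wi] := dw i; split.
  exact: (semi_inner_closedB ipP Lvi Lwi).
exact: weak_partialB.
Qed.

Definition grad_ip (v w : wdiff R d) : R := \sum_i ip (v.2 i) (w.2 i).

Lemma grad_ip_semi_inner :
  semi_inner (fun v : wdiff R d => forall i, L2 (v.2 i)) grad_ip.
Proof.
apply: semi_inner_sum => i.
exact: (semi_inner_comp (L := fun v : wdiff R d => v.2 i) _
  (ip_semi_inner vol mOm)).
Qed.

Definition H1_ip (v w : wdiff R d) : R := ip v.1 w.1 + grad_ip v w.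

Lemma H1_ip_semi_inner :
  semi_inner (fun v : wdiff R d => L2 v.1 /\ forall i, L2 (v.2 i)) H1_ip.
Proof.
apply: semi_inner_add; last exact: grad_ip_semi_inner.
exact: (semi_inner_comp (L := fun v : wdiff R d => v.1) _
  (ip_semi_inner vol mOm)).
Qed.

Local Notation H1L2 v := (L2 v.1 /\ forall i, L2 (v.2 i)).

Lemma H1_L2 (v : wdiff R d) : H1 Om v -> H1L2 v.
Proof. by move=> [Lv dv]; split=> // i; case: (dv i). Qed.

Lemma norm_gradE (v : wdiff R d) : (forall i, L2 (v.2 i)) ->
  norm_grad Om v = Num.sqrt (grad_ip v v).
Proof.
by move=> Lv; rewrite /grad_ip -Rintegral_sum_prod.
Qed.

Lemma normH1E (v : wdiff R d) : H1L2 v -> normH1 Om v = Num.sqrt (H1_ip v v).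
Proof.
move=> [L0 Lv]; rewrite /normH1 norm_gradE//.
rewrite (sqr_seminorm (ip_semi_inner vol mOm)).
by rewrite (sqr_seminorm grad_ip_semi_inner).
Qed.

Lemma normH1_ge0 (v : wdiff R d) : 0 <= normH1 Om v.
Proof. exact: sqrtr_ge0. Qed.

Lemma normH1_leB (v w : wdiff R d) : H1 Om v -> H1 Om w ->
  normH1 Om (v - w) <= normH1 Om v + normH1 Om w.
Proof.
move=> Hv Hw; rewrite !normH1E; try exact: H1_L2; last exact: H1_L2 (H1B Hv Hw).
exact: (minkowskiB H1_ip_semi_inner (H1_L2 Hv) (H1_L2 Hw)).
Qed.

Lemma cvg0_leD (f g h : nat -> R) : (forall n, 0 <= h n <= f n + g n) ->
  f n @[n --> \oo] --> 0 -> g n @[n --> \oo] --> 0 -> h n @[n --> \oo] --> 0.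
Proof.
move=> hfg f0 g0; apply: (squeeze_cvgr (f := fun=> 0) (h := fun n => f n + g n)).
- by near=> n; exact: hfg.
- exact: cvg_cst.
- by rewrite -[0 in X in _ --> X](addr0 0); exact: cvgD.
Unshelve. all: by end_near. Qed.

(** The differences of the approximating smooth functions approximate the
    difference, by Minkowski's inequality in H^1 and on the boundary. *)
Lemma zero_traceB (sigma : {measure set pt -> \bar R}) (Gam : set pt)
    (v w : wdiff R d) : measurable Gam -> H1 Om v -> H1 Om w ->
  zero_trace Om sigma Gam v -> zero_trace Om sigma Gam w ->
  zero_trace Om sigma Gam (v - w).
Proof.
move=> mG Hv Hw [f [fP vf f0]] [g [gP wg g0]].
have sigmaP := ip_semi_inner sigma mG.
exists (fun n => f n - g n); split.
- move=> n; have [sf Hf Lf] := fP n; have [sg Hg Lg] := gP n; split.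
  + exact: smoothB.
  + by rewrite of_smoothB//; exact: H1B.
  + exact: (semi_inner_closedB sigmaP).
- apply: (cvg0_leD _ vf wg) => n; rewrite normH1_ge0 /=.
  have [sf Hf _] := fP n; have [sg Hg _] := gP n.
  rewrite of_smoothB// [X in normH1 _ X](_ : _ =
    (v - of_smooth (f n)) - (w - of_smooth (g n))).
    by apply: normH1_leB; exact: H1B.
  by rewrite !opprD !opprK addrACA.
- apply: (cvg0_leD _ f0 g0) => n; rewrite sqrtr_ge0 /=.
  have [_ _ Lf] := fP n; have [_ _ Lg] := gP n.
  exact: (minkowskiB sigmaP Lf Lg).
Qed.

Lemma H10B (sigma : {measure set pt -> \bar R}) (Gam : set pt)
    (v w : wdiff R d) : measurable Gam ->
  H10 Om sigma Gam v -> H10 Om sigma Gam w -> H10 Om sigma Gam (v - w).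
Proof.
move=> mG [Hv tv] [Hw tw]; split; first exact: H1B.
exact: zero_traceB.
Qed.

Definition strain_ip (u v : wvec R d) : R :=
  \sum_i \sum_j ip (strain u i j) (strain v i j).

Local Notation gradL2v u := (forall i j, L2 ((u i).2 j)).

Lemma strain_linear i j : linear (fun u : wvec R d => strain u i j).
Proof.
move=> c u v; apply/funext => x.
rewrite /strain -[RHS]/(c * _ + _).
rewrite -[((c *: u + v) i).2 j x]/(c * (u i).2 j x + (v i).2 j x).
rewrite -[((c *: u + v) j).2 i x]/(c * (u j).2 i x + (v j).2 i x).
ring.
Qed.

Lemma strain_L2 (u : wvec R d) i j : gradL2v u -> L2 (strain u i j).
Proof.
move=> Lu; have ipP := ip_semi_inner vol mOm.
exact: (semi_inner_closedZ ipP _ (semi_inner_closedD ipP (Lu i j) (Lu j i))).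
Qed.

Lemma strain_ip_semi_inner : semi_inner
  (fun u : wvec R d => forall i j, L2 (strain u i j)) strain_ip.
Proof.
apply: semi_inner_sum => i; apply: semi_inner_sum => j.
exact: (semi_inner_comp (strain_linear i j) (ip_semi_inner vol mOm)).
Qed.

Lemma strain_ipE (u v : wvec R d) : gradL2v u -> gradL2v v ->
  \int[vol]_(x in Om) (\sum_i \sum_j strain u i j x * strain v i j x) =
  strain_ip u v.
Proof.
move=> Lu Lv; under eq_Rintegral do rewrite pair_bigA /=.
by rewrite Rintegral_sum_prod ?[RHS]pair_bigA// => -[i j] /=; exact: strain_L2.
Qed.

Lemma norm_strainE (u : wvec R d) : gradL2v u ->
  norm_strain Om u = Num.sqrt (strain_ip u u).
Proof. by move=> Lu; rewrite -strain_ipE. Qed.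

(** Pointwise, the symmetric part of a matrix has a Frobenius norm no larger
    than that of the matrix. *)
Lemma norm_strain_le (u : wvec R d) : (forall j, H1 Om (u j)) ->
  norm_strain Om u <= normH1v Om u.
Proof.
move=> Hu; have ipP := ip_semi_inner vol mOm.
have Lu i j : L2 ((u i).2 j) by case: (H1_L2 (Hu i)).
rewrite norm_strainE//; apply: ler_wsqrtr.
apply: (@le_trans _ _ (\sum_i grad_ip (u i) (u i))); last first.
  apply: ler_sum => i _; rewrite (normH1E (H1_L2 (Hu i))).
  rewrite (sqr_seminorm H1_ip_semi_inner).
  by rewrite lerDr (semi_inner_ge0 ipP).
rewrite /strain_ip /grad_ip.
(* Convexity of the square, applied to the two halves of the strain. *)
have le_ij i j : ip (strain u i j) (strain u i j) <=
    2^-1 * ip ((u i).2 j) ((u i).2 j) + 2^-1 * ip ((u j).2 i) ((u j).2 i).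
  rewrite -[strain u i j]/(2^-1 *: ((u i).2 j + (u j).2 i)).
  set f := (u i).2 j; set g := (u j).2 i.
  have Lf : L2 f := Lu i j; have Lg : L2 g := Lu j i.
  have Lfg := semi_inner_closedD ipP Lf Lg.
  rewrite (semi_innerZl ipP) ?(semi_innerZr ipP)//; last first.
    exact: semi_inner_closedZ ipP _ _ Lfg.
  have := semi_inner_ge0 ipP (f - g).
  rewrite !(semi_innerBl ipP) ?(semi_innerDl ipP) ?(semi_innerBr ipP)
    ?(semi_innerDr ipP) ?(semi_inner_sym ipP g f)//;
    last exact: semi_inner_closedB ipP _ _ Lf Lg.
  lra.
apply: (@le_trans _ _ (\sum_i \sum_j (2^-1 * ip ((u i).2 j) ((u i).2 j) +
    2^-1 * ip ((u j).2 i) ((u j).2 i)))).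
  by apply: ler_sum => i _; apply: ler_sum => j _; exact: le_ij.
(* Both halves have the same sum after exchanging i and j. *)
under eq_bigr do rewrite big_split.
rewrite big_split /= [X in _ + X]exchange_big /= -big_split.
under eq_bigr do rewrite -big_split /=.
by apply: ler_sum => i _; apply: ler_sum => j _; rewrite -mulrDl; lra.
Qed.

End SobolevTheory.

(** * The discrete spaces and the elasticity step *)

Lemma piecewise_polyB (R : realType) (d k : nat) (Th : seq 'M[R]_(d.+1, d))
    (f g : 'rV[R]_d -> R) :
  piecewise_poly k Th f -> piecewise_poly k Th g -> piecewise_poly k Th (f - g).
Proof.
move=> pf pg E ETh; have [p [degp fp]] := pf E ETh.
have [q [degq gq]] := pg E ETh.
exists (p - q); split=> [m|x Ex].
  move=> /mpoly.msuppD_le; rewrite mem_cat => /orP[/degp//|].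
  by rewrite (perm_mem (mpoly.msuppN q)) => /degq.
by rewrite mpoly.mevalB -fp// -gq.
Qed.

Section BiotEstimates.
Variables (R : realType) (d : nat) (B : biot R d).
Local Notation pt := 'rV[R]_d.
Local Notation vol := (leb R d).
Local Notation sigma := (surface_measure (faces B)).
Local Notation Om := (Om B).
Local Notation L2 := (L2 vol Om).
Local Notation ip := (ip vol Om).
Local Notation normL2 := (normL2 vol Om).
Local Notation lam := (lam B).
Local Notation mu := (mu B).
Local Notation alpha := (alpha B).
Local Notation kp := (kp B).

Variables (k l : nat) (Th : seq 'M[R]_(d.+1, d)).
Local Notation Vh := (Vh B k Th).
Local Notation Wh := (Wh B k Th).
Local Notation Mh := (Mh B l Th).

Hypothesis adm : admissible B.

Let oOm : open Om. Proof. by case: adm => -[]. Qed.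
Let mOm : measurable Om. Proof. exact: open_measurable_rV. Qed.
Let bOm : bounded_set Om. Proof. by case: adm => -[]. Qed.
Let mGu : measurable (Gu B). Proof. by case: adm => _ []. Qed.
Let mGp : measurable (Gp B). Proof. by case: adm => _ _ []. Qed.
Let lam_gt0 : 0 < lam. Proof. by case: adm => _ _ _ []. Qed.
Let mu_gt0 : 0 < mu. Proof. by case: adm => _ _ _ []. Qed.
Let alpha_gt0 : 0 < alpha. Proof. by case: adm => _ _ _ []. Qed.
Let kp_gt0 : 0 < kp. Proof. by case: adm => _ _ _ []. Qed.
Let c0_ge0 : 0 <= c0 B. Proof. by case: adm. Qed.

Let ipP := ip_semi_inner vol mOm.
Let gradP := grad_ip_semi_inner mOm.
Let strainP := strain_ip_semi_inner mOm.

Lemma VhB u v : Vh u -> Vh v -> Vh (u - v).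
Proof.
move=> Hu Hv j; have [H0u cu pu] := Hu j; have [H0v cv pv] := Hv j; split.
- exact: H10B.
- by move=> x; exact: (continuousB (cu x) (cv x)).
- exact: piecewise_polyB.
Qed.

Lemma WhB f g : Wh f -> Wh g -> Wh (f - g).
Proof.
move=> [Lf cf pf] [Lg cg pg]; split.
- exact: (semi_inner_closedB ipP Lf Lg).
- by move=> x; exact: (continuousB (cf x) (cg x)).
- exact: piecewise_polyB.
Qed.

Lemma MhB p q : Mh p -> Mh q -> Mh (p - q).
Proof.
move=> [Hp cp pp] [Hq cq pq]; split.
- exact: H10B.
- by move=> x; exact: (continuousB (cp x) (cq x)).
- exact: piecewise_polyB.
Qed.

Lemma Wh_L2 f : Wh f -> L2 f. Proof. by case. Qed.

Lemma Vh_H1 u j : Vh u -> H1 Om (u j). Proof. by move=> /(_ j) [[]]. Qed.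

Lemma Vh_grad_L2 u i j : Vh u -> L2 ((u i).2 j).
Proof. by move=> /(Vh_H1 i) /H1_L2 []. Qed.

Lemma Mh_L2 p : Mh p -> L2 p.1.
Proof. by move=> [[/H1_L2 []]]. Qed.

Lemma Mh_grad_L2 p i : Mh p -> L2 (p.2 i).
Proof. by move=> [[/H1_L2 []]]. Qed.

Lemma Vh_strain_L2 u i j : Vh u -> L2 (strain u i j).
Proof. by move=> Hu; apply: strain_L2 => // a b; exact: Vh_grad_L2. Qed.

Lemma form_a1E u v : Vh u -> Vh v -> form_a1 B u v = 2 * mu * strain_ip Om u v.
Proof.
by move=> Hu Hv; rewrite /form_a1 strain_ipE// => i j; exact: Vh_grad_L2.
Qed.

Lemma form_dE (p q : wdiff R d) : (forall i, L2 (p.2 i)) ->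
  (forall i, L2 (q.2 i)) -> form_d B p q = kp * grad_ip Om p q.
Proof. by move=> Lp Lq; rewrite /form_d Rintegral_sum_prod. Qed.

Lemma form_bE v phi : form_b B v phi = ip phi (divergence v).
Proof. by []. Qed.

Lemma divergence_L2 v : Vh v -> L2 (divergence v).
Proof.
move=> Hv; rewrite (_ : divergence v = \sum_i (v i).2 i); last first.
  by apply/funext => x; rewrite fct_sumE.
have Lv i : L2 ((v i).2 i) by exact: Vh_grad_L2.
elim/big_ind : _ => //; last by move=> f g; exact: semi_inner_closedD ipP _ _.
by split; [exact: measurable_cst|under eq_integral do rewrite expr0n;
  rewrite integral0 ltry].
Qed.

Lemma divergenceB (u v : wvec R d) :
  divergence (u - v) = divergence u - divergence v.
Proof.
apply/funext => x; rewrite /divergence -[RHS]/(_ - _) -sumrB.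
by apply: eq_bigr.
Qed.

(** The residual [G] of the second equation covers time level 0, where the error
    is the difference of two triples of initial data whose residuals are equal
    but need not vanish. *)
Definition elasticity_system (F : wvec R d -> R) (G : (pt -> R) -> R)
    (u : wvec R d) (xi p : pt -> R) : Prop :=
  (forall v, Vh v -> form_a1 B u v - form_b B v xi = F v) /\
  (forall phi, Wh phi ->
    form_b B u phi + form_a2 B xi phi - form_c B p phi = G phi).

Lemma elasticity_systemB (F F' : wvec R d -> R) (G G' : (pt -> R) -> R)
    u v xi eta p q :
  Vh u -> Vh v -> Wh xi -> Wh eta -> L2 p -> L2 q ->
  elasticity_system F G u xi p -> elasticity_system F' G' v eta q ->
  elasticity_system (fun w => F w - F' w) (fun phi => G phi - G' phi)
    (u - v) (xi - eta) (p - q).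
Proof.
move=> Hu Hv Hxi Heta Lp Lq [u1 u2] [v1 v2].
have Lxi := Wh_L2 Hxi; have Leta := Wh_L2 Heta.
split=> [w Hw|phi Hphi].
  have Lw := divergence_L2 Hw.
  rewrite -u1// -v1// !form_bE (semi_innerBl ipP)// !form_a1E//; last exact: VhB.
  rewrite (semi_innerBl strainP); first ring.
  - by move=> i j; exact: Vh_strain_L2.
  - by move=> i j; exact: Vh_strain_L2.
  - by move=> i j; exact: Vh_strain_L2.
have Lphi := Wh_L2 Hphi.
have Lu := divergence_L2 Hu; have Lv := divergence_L2 Hv.
rewrite -u2// -v2//
  /form_a2 /form_c !form_bE divergenceB (semi_innerBr ipP)//.
rewrite !(semi_innerBl ipP)//; ring.
Qed.

Section InfSup.
Variable beta : R.
Hypothesis beta_gt0 : 0 < beta.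
Hypothesis infsup : inf_sup B k Th beta.
Variables (u : wvec R d) (xi p : pt -> R).
Hypotheses (Hu : Vh u) (Hxi : Wh xi) (Lp : L2 p).
Hypothesis sys : elasticity_system (fun=> 0) (fun=> 0) u xi p.

Let eps := norm_strain Om u.
Let eps_ge0 : 0 <= eps. Proof. exact: sqrtr_ge0. Qed.
Let xi_ge0 : 0 <= normL2 xi. Proof. exact: sqrtr_ge0. Qed.

(** By the first equation b(v, xi) = a_1(u, v), which Cauchy-Schwarz bounds by
    2 mu |eps(u)| |v|; the inf-sup condition turns this into a bound on [xi]. *)
Lemma infsup_multiplier_le : beta * normL2 xi <= 2 * mu * eps.
Proof.
rewrite -lee_fin; apply: (le_trans (infsup Hxi)); apply: ge_ereal_sup.
move=> _ [v [Hv v0] <-]; rewrite lee_fin.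
have vpos : 0 < normH1v Om v by rewrite lt_neqAle eq_sym v0 sqrtr_ge0.
have /eqP := sys.1 _ Hv; rewrite subr_eq0 => /eqP <-.
rewrite form_a1E// ler_pdivrMr// -[leRHS]mulrA.
rewrite ler_wpM2l//; first by rewrite mulr_ge0// ltW.
have Su i j : L2 (strain u i j) by exact: Vh_strain_L2.
have Sv i j : L2 (strain v i j) by exact: Vh_strain_L2.
apply: (le_trans (ler_norm _)); apply: (le_trans (cauchy_schwarz strainP Su Sv)).
rewrite /eps (norm_strainE mOm); last by move=> i j; exact: Vh_grad_L2.
rewrite ler_wpM2l ?sqrtr_ge0//.
rewrite -(norm_strainE mOm); last by move=> i j; exact: Vh_grad_L2.
by apply: norm_strain_le => // j; exact: Vh_H1.
Qed.

(** The test functions u and xi: the two terms b(u, xi) cancel. *)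
Lemma elastic_energy :
  2 * mu * eps ^+ 2 + lam^-1 * normL2 xi ^+ 2 <=
  alpha / lam * (normL2 p * normL2 xi).
Proof.
have [s1 s2] := sys; have e1 := s1 _ Hu; have e2 := s2 _ Hxi.
move/eqP: e2; rewrite subr_eq0 => /eqP.
have -> : form_b B u xi = form_a1 B u u by lra.
rewrite form_a1E// /form_a2 /form_c.
rewrite /normL2 (sqr_seminorm ipP) => e2.
rewrite /eps (norm_strainE mOm); last by move=> i j; exact: Vh_grad_L2.
rewrite (sqr_seminorm strainP) e2 ler_wpM2l//.
  by rewrite divr_ge0// ltW.
by apply: (le_trans (ler_norm _)); apply: (cauchy_schwarz ipP Lp); exact: Wh_L2.
Qed.

(** The inf-sup bound replaces the strain in the energy by (beta^2/(2 mu)) |xi|^2,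
    and one factor |xi| cancels. *)
Lemma multiplier_le_pressure :
  (beta ^+ 2 / (2 * mu) * lam + 1) * normL2 xi <= alpha * normL2 p.
Proof.
have [->|x0] := eqVneq (normL2 xi) 0.
  by rewrite mulr0 mulr_ge0 ?sqrtr_ge0 ?ltW.
have xpos : 0 < normL2 xi by rewrite lt_neqAle eq_sym x0.
rewrite -(ler_pM2r xpos).
have E := elastic_energy; have I := infsup_multiplier_le.
have I2 : beta ^+ 2 / (2 * mu) * normL2 xi ^+ 2 <= 2 * mu * eps ^+ 2.
  rewrite mulrAC. rewrite ler_pdivrMr; last by rewrite mulr_gt0.
  have -> : 2 * mu * eps ^+ 2 * (2 * mu) = (2 * mu * eps) ^+ 2 by ring.
  by rewrite -exprMn ler_sqr// nnegrE mulr_ge0// ltW// mulr_gt0.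
have E3 := le_trans (lerD I2 (lexx (lam^-1 * normL2 xi ^+ 2))) E.
have := ler_wpM2l (ltW lam_gt0) E3.
suff -> : lam * (alpha / lam * (normL2 p * normL2 xi)) =
    alpha * normL2 p * normL2 xi.
  apply: le_trans; rewrite le_eqVlt; apply/orP; left; apply/eqP.
  by field; rewrite !gt_eqF.
by field; rewrite gt_eqF.
Qed.

(** The inf-sup bound replaces |xi| on the right of the energy by the strain, and
    one factor |eps(u)| cancels. *)
Lemma strain_le_pressure : lam * beta * eps <= alpha * normL2 p.
Proof.
have [->|e0] := eqVneq eps 0.
  by rewrite mulr0 mulr_ge0 ?sqrtr_ge0 ?ltW.
have epos : 0 < eps by rewrite lt_neqAle eq_sym e0.
have E := elastic_energy; have I := infsup_multiplier_le.
have pp : 0 <= normL2 p by exact: sqrtr_ge0.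
have E1 : 2 * mu * eps ^+ 2 <= alpha / lam * (normL2 p * normL2 xi).
  apply: le_trans E; rewrite lerDl mulr_ge0 ?exprn_ge0//.
  by rewrite invr_ge0 ltW.
have E2 : beta * (2 * mu * eps ^+ 2) <=
    alpha / lam * normL2 p * (2 * mu * eps).
  apply: (le_trans (y := alpha / lam * normL2 p * (beta * normL2 xi))).
    have -> : alpha / lam * normL2 p * (beta * normL2 xi) =
      beta * (alpha / lam * (normL2 p * normL2 xi)) by ring.
    by rewrite ler_pM2l.
  by rewrite ler_wpM2l// mulr_ge0// divr_ge0// ltW.
have cpos : 0 < 2 * mu * eps / lam by rewrite !mulr_gt0 ?invr_gt0.
rewrite -(ler_pM2r cpos).
have -> : lam * beta * eps * (2 * mu * eps / lam) = beta * (2 * mu * eps ^+ 2).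
  by field; rewrite gt_eqF.
apply: (le_trans E2); rewrite le_eqVlt; apply/orP; left; apply/eqP.
by field; rewrite gt_eqF.
Qed.

End InfSup.

(** * The pressure step *)

Lemma normL2_sqr f : normL2 f ^+ 2 = ip f f.
Proof. exact: (sqr_seminorm ipP). Qed.

Let a3 : R := c0 B + alpha ^+ 2 / lam.
Let a3_gt0 : 0 < a3.
Proof. by rewrite ltr_wpDl// divr_gt0// exprn_gt0. Qed.

(** The loads cancel, and multiplying by dt removes the difference quotients. *)
Lemma pressure_error (D : data R d) (dt : R) (n : nat)
    (p q p' q' : wdiff R d) (xi eta xi' eta' : pt -> R) : 0 < dt ->
  Mh p -> Mh q -> Mh p' -> Mh q' -> Wh xi -> Wh eta -> Wh xi' -> Wh eta' ->
  pressure_step B l Th D dt n p p' xi xi' ->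
  pressure_step B l Th D dt n q q' eta eta' ->
  forall psi, Mh psi ->
    a3 * ip ((p - q) - (p' - q')).1 psi.1 +
      dt * kp / 2 * grad_ip Om ((p - q) + (p' - q')) psi =
    alpha / lam * ip ((xi - eta) - (xi' - eta')) psi.1.
Proof.
move=> dt0 Hp Hq Hp' Hq' /Wh_L2 Lxi /Wh_L2 Leta /Wh_L2 Lxi' /Wh_L2 Leta' sp sq.
move=> psi Hpsi.
have Lpsi := Mh_L2 Hpsi; have Gpsi i := Mh_grad_L2 i Hpsi.
have Lp := Mh_L2 Hp; have Gp i := Mh_grad_L2 i Hp.
have Lq := Mh_L2 Hq; have Gq i := Mh_grad_L2 i Hq.
have Lp' := Mh_L2 Hp'; have Gp' i := Mh_grad_L2 i Hp'.
have Lq' := Mh_L2 Hq'; have Gq' i := Mh_grad_L2 i Hq'.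
pose B0 := semi_inner_closedB ipP; pose GB := semi_inner_closedB gradP.
pose GD := semi_inner_closedD gradP.
have expand (r r' : wdiff R d) (x x' : pt -> R) :
    Mh r -> Mh r' -> L2 x -> L2 x' ->
    form_a3 B (dt^-1 *: (r.1 - r'.1)) psi.1 - form_c B psi.1 (dt^-1 *: (x - x'))
      + form_d B (2^-1 *: (r + r')) psi =
    dt^-1 * (a3 * (ip r.1 psi.1 - ip r'.1 psi.1)
      - alpha / lam * (ip x psi.1 - ip x' psi.1)
      + dt * kp / 2 * (grad_ip Om r psi + grad_ip Om r' psi)).
  move=> Hr Hr' Lx Lx'.
  have Lr := Mh_L2 Hr; have Gr i := Mh_grad_L2 i Hr.
  have Lr' := Mh_L2 Hr'; have Gr' i := Mh_grad_L2 i Hr'.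
  rewrite form_dE//; last exact: (semi_inner_closedZ gradP _ (GD _ _ Gr Gr')).
  rewrite (semi_innerZl gradP)//; last exact: GD.
  rewrite (semi_innerDl gradP)// /form_a3 /form_c.
  rewrite (semi_innerZl ipP)//; last exact: B0.
  rewrite (semi_inner_sym ipP psi.1) (semi_innerZl ipP)//; last exact: B0.
  rewrite !(semi_innerBl ipP)// -/a3.
  by field; rewrite !gt_eqF.
have Ep := sp _ Hpsi; have Eq := sq _ Hpsi.
move: Ep; rewrite -Eq !expand// => /mulfI.
rewrite invr_eq0 gt_eqF// => /(_ isT) E.
have -> : ip ((p - q) - (p' - q')).1 psi.1 =
    ip p.1 psi.1 - ip q.1 psi.1 - (ip p'.1 psi.1 - ip q'.1 psi.1).
  have -> : ((p - q) - (p' - q')).1 = (p.1 - q.1) - (p'.1 - q'.1) by [].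
  by rewrite !(semi_innerBl ipP)//; exact: B0.
rewrite (semi_innerDl gradP)//; [|exact: GB|exact: GB].
rewrite !(semi_innerBl gradP)//.
rewrite !(semi_innerBl ipP)//; [|exact: B0|exact: B0].
lra.
Qed.

(** The test function is e - e', for which the diffusion term is a difference of
    squares; Young's inequality bounds the coupling term. *)
Lemma pressure_energy_step (dt : R) (e e' : wdiff R d) (x x' : pt -> R) :
  0 < dt -> Mh e -> Mh e' -> Wh x -> Wh x' ->
  (forall psi, Mh psi ->
    a3 * ip (e - e').1 psi.1 + dt * kp / 2 * grad_ip Om (e + e') psi =
    alpha / lam * ip (x - x') psi.1) ->
  a3 * ip (e - e').1 (e - e').1
    + dt * kp * (grad_ip Om e e - grad_ip Om e' e') <=
  alpha ^+ 2 / (lam ^+ 2 * a3) * ip (x - x') (x - x').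
Proof.
move=> dt0 He He' Hx Hx' /(_ _ (MhB He He')).
have Ge i := Mh_grad_L2 i He; have Ge' i := Mh_grad_L2 i He'.
set f := (e - e').1; set g := x - x'.
have Lf : L2 f by exact: Mh_L2 (MhB He He').
have Lg : L2 g by exact: Wh_L2 (WhB Hx Hx').
have -> : grad_ip Om (e + e') (e - e') = grad_ip Om e e - grad_ip Om e' e'.
  have GB : forall i, L2 ((e - e').2 i) by exact: (semi_inner_closedB gradP).
  rewrite (semi_innerDl gradP)// !(semi_innerBr gradP)//.
  rewrite (semi_inner_sym gradP e' e); ring.
move=> E.
(* Expanding a3 |f - (alpha / (lam a3)) g|^2 >= 0 is Young's inequality; it
   absorbs one of the two a3 |f|^2 in twice the tested equation. *)
have := semi_inner_ge0 ipP ((- (alpha / (lam * a3))) *: g + f).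
rewrite (semi_inner_expand ipP)// => Y.
have := ler_wpM2l (ltW a3_gt0) Y; rewrite mulr0.
have -> : a3 * ((- (alpha / (lam * a3))) ^+ 2 * ip g g +
    2 * (- (alpha / (lam * a3))) * ip g f + ip f f) =
    alpha ^+ 2 / (lam ^+ 2 * a3) * ip g g - 2 * (alpha / lam * ip g f)
    + a3 * ip f f.
  by field; rewrite !gt_eqF.
rewrite -E; lra.
Qed.

Lemma pressure_energy (dt : R) (e : nat -> wdiff R d) (x : nat -> pt -> R)
    (N : nat) : 0 < dt -> e 0%N = 0 ->
  (forall n, (n <= N)%N -> Mh (e n)) -> (forall n, (n <= N)%N -> Wh (x n)) ->
  (forall n, (0 < n <= N)%N -> forall psi, Mh psi ->
    a3 * ip (e n - e n.-1).1 psi.1 + dt * kp / 2 * grad_ip Om (e n + e n.-1) psi =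
    alpha / lam * ip (x n - x n.-1) psi.1) ->
  a3 * (\sum_(1 <= n < N.+1) normL2 (e n - e n.-1).1 ^+ 2)
    + dt * kp * grad_ip Om (e N) (e N) <=
  alpha ^+ 2 / (lam ^+ 2 * a3) *
    \sum_(1 <= n < N.+1) normL2 (x n - x n.-1) ^+ 2.
Proof.
move=> dt0 e0; elim: N => [|N IH] He Hx eqn.
  rewrite !big_nil e0 /grad_ip big1 ?mulr0 ?addr0 ?lexx// => i _.
  have : L2 ((0 : wdiff R d).2 i) by rewrite -e0; exact: Mh_grad_L2 (He 0%N _).
  move=> L0; rewrite -(subrr (0 : wdiff R d)).
  rewrite -[((0 - 0 : wdiff R d).2 i)]/((0 : wdiff R d).2 i
    - (0 : wdiff R d).2 i).
  by rewrite (semi_innerBl ipP) ?subrr//; exact: (semi_inner_closedB ipP).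
have /IH {}IH : forall n, (n <= N)%N -> Mh (e n).
  by move=> n nN; apply: He; exact: leqW.
have /IH {}IH : forall n, (n <= N)%N -> Wh (x n).
  by move=> n nN; apply: Hx; exact: leqW.
have {}IH := IH (fun n nN => eqn n ltac:(by move: nN => /andP[-> /leqW])).
have := pressure_energy_step dt0 (He N.+1 (leqnn _)) (He N (leqnSn _))
  (Hx N.+1 (leqnn _)) (Hx N (leqnSn _)) (eqn N.+1 (leqnn _)).
have recr (F : nat -> R) :
    \sum_(1 <= n < N.+2) F n = \sum_(1 <= n < N.+1) F n + F N.+1.
  by rewrite big_nat_recr.
rewrite !recr !normL2_sqr -[N.+1.-1]/N.
set K := alpha ^+ 2 / _ in IH *. lra.
Qed.

Lemma homogeneous_systemB (F : wvec R d -> R) (G : (pt -> R) -> R)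
    u v xi eta p q :
  Vh u -> Vh v -> Wh xi -> Wh eta -> L2 p -> L2 q ->
  elasticity_system F G u xi p -> elasticity_system F G v eta q ->
  elasticity_system (fun=> 0) (fun=> 0) (u - v) (xi - eta) (p - q).
Proof.
move=> Hu Hv Hxi Heta Lp Lq su sv.
have [E1 E2] := elasticity_systemB Hu Hv Hxi Heta Lp Lq su sv.
by split=> [w /E1|w /E2]; rewrite subrr.
Qed.

(** * Estimates for the iteration errors *)

Section Iteration.
Variables (beta dt : R) (N : nat) (D : data R d).
Variables (u : nat -> wvec R d) (xi : nat -> pt -> R) (p : nat -> wdiff R d).
Variables (ui : nat -> nat -> wvec R d) (xii : nat -> nat -> pt -> R)
  (pii : nat -> nat -> wdiff R d).
Hypotheses (beta_gt0 : 0 < beta) (infsup : inf_sup B k Th beta).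
Hypothesis dt_gt0 : 0 < dt.
Hypothesis coupled : coupled_solution B k l Th D dt N u xi p.
Hypothesis decoupled : decoupled_iterates B k l Th D dt N
  (u 0%N) (xi 0%N) (p 0%N) ui xii pii.

Local Notation eu i n := (ui i n - u n).
Local Notation exi i n := (xii i n - xi n).
Local Notation ep i n := (pii i n - p n).
Local Notation S i :=
  (\sum_(1 <= n < N.+1) normL2 (exi i n - exi i n.-1) ^+ 2).

Lemma iterates_mem i n : (0 < i)%N -> (n <= N)%N ->
  [/\ Vh (ui i n), Wh (xii i n) & Mh (pii i n)].
Proof.
move=> i0; have [_ /(_ i i0)[ui0 xii0 pii0] stepp stepe] := decoupled.
case: n => [|n] nN.
  by rewrite ui0 xii0 pii0; case: coupled => /(_ 0%N nN).
have [Mp _] := stepp i n.+1 i0 nN; have [Vu Wxi _] := stepe i n.+1 i0 nN.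
by split.
Qed.

Lemma xi_iterates_mem i n : (n <= N)%N -> Wh (xii i n).
Proof.
case: i => [|i] nN; last by have [] := @iterates_mem i.+1 n erefl nN.
have [/(_ n nN)[_ -> _] _ _ _] := decoupled.
by case: coupled => /(_ 0%N (leq0n _))[].
Qed.

Lemma error_mem i n : (0 < i)%N -> (n <= N)%N ->
  [/\ Vh (eu i n), Wh (exi i n) & Mh (ep i n)].
Proof.
move=> i0 nN; have [Vui Wxii Mpii] := iterates_mem i0 nN.
have [/(_ n nN)[Vu Wxi Mp] _] := coupled.
by split; [exact: VhB|exact: WhB|exact: MhB].
Qed.

(** At level 0 the iterate and the solution share the initial data, so both have
    the same residuals; at later levels they have the same loads. *)
Lemma error_elasticity i n : (0 < i)%N -> (n <= N)%N ->
  elasticity_system (fun=> 0) (fun=> 0) (eu i n) (exi i n) (ep i n).1.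
Proof.
move=> i0 nN; have [Vui Wxii Mpii] := iterates_mem i0 nN.
have [/(_ n nN)[Vu Wxi Mp] eqs] := coupled.
case: n nN Vui Wxii Mpii Vu Wxi Mp => [_|n nN] Vui Wxii Mpii Vu Wxi Mp.
  have [_ /(_ i i0)[-> -> ->] _ _] := decoupled.
  apply: (@homogeneous_systemB
    (fun v => form_a1 B (u 0%N) v - form_b B v (xi 0%N))
    (fun phi => form_b B (u 0%N) phi + form_a2 B (xi 0%N) phi
       - form_c B (p 0%N).1 phi)) => //; exact: Mh_L2.
have [eq1 eq2 _] := eqs n.+1 nN.
have [_ _ _ /(_ i n.+1 i0 nN)[_ _ [it1 it2]]] := decoupled.
apply: (@homogeneous_systemB (load_u B D (n.+1%:R * dt)) (fun=> 0)) => //;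
  try exact: Mh_L2.
by split=> // phi Wphi; rewrite it2// subrr.
Qed.

Lemma error_pressure i n : (0 < i)%N -> (0 < n <= N)%N -> forall psi, Mh psi ->
  a3 * ip (ep i n - ep i n.-1).1 psi.1
    + dt * kp / 2 * grad_ip Om (ep i n + ep i n.-1) psi =
  alpha / lam * ip (exi i.-1 n - exi i.-1 n.-1) psi.1.
Proof.
move=> i0 n0N; have /andP[n0 nN] := n0N.
have n1N : (n.-1 <= N)%N by exact: leq_trans (leq_pred _) nN.
have [_ _ Mpii] := iterates_mem i0 nN; have [_ _ Mpii'] := iterates_mem i0 n1N.
have [mem eqs] := coupled; have [_ Wxi Mp] := mem n nN.
have [_ Wxi' Mp'] := mem _ n1N; have [_ _ stepc] := eqs n n0N.
have [_ _ /(_ i n i0 n0N)[_ stepi] _] := decoupled.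
by apply: pressure_error stepi stepc => //; exact: xi_iterates_mem.
Qed.

Let Cb := beta ^+ 2 / (2 * mu).
Let Lg := ((c0 B * lam / alpha ^+ 2 + 1) * (Cb * lam + 1))^-1.

Lemma Lg_bounds : 0 < Lg < 1.
Proof.
have Cb0 : 0 < Cb * lam by rewrite mulr_gt0// divr_gt0 ?exprn_gt0// mulr_gt0.
have g0 : 0 <= c0 B * lam / alpha ^+ 2.
  by rewrite divr_ge0 ?exprn_ge0 ?mulr_ge0// ltW.
have D1 : 1 < (c0 B * lam / alpha ^+ 2 + 1) * (Cb * lam + 1) by nra.
by rewrite invr_gt0 (lt_trans ltr01 D1)/= invf_lt1// (lt_trans ltr01).
Qed.

Lemma iteration_energy i : (0 < i)%N ->
  a3 * (\sum_(1 <= n < N.+1) normL2 (ep i n - ep i n.-1).1 ^+ 2)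
    + dt * kp * grad_ip Om (ep i N) (ep i N) <=
  alpha ^+ 2 / (lam ^+ 2 * a3) * S i.-1.
Proof.
move=> i0.
apply: (@pressure_energy dt (fun n => ep i n) (fun n => exi i.-1 n)) => //.
- by have [_ /(_ i i0)[_ _ ->] _ _] := decoupled; rewrite subrr.
- by move=> n nN; have [] := error_mem i0 nN.
- move=> n nN; apply: WhB; first exact: xi_iterates_mem.
  by have [/(_ n nN)[]] := coupled.
- by move=> n nN; exact: error_pressure.
Qed.

Lemma S_ge0 i : 0 <= S i.
Proof. by apply: sumr_ge0 => n _; rewrite exprn_ge0// sqrtr_ge0. Qed.

(** The elasticity estimate on increments and the pressure energy together give
    the factor alpha^4 / (lambda^2 A^2 (C lambda + 1)^2) = Lg^2, at most Lg. *)
Lemma contraction i : (0 < i)%N -> S i <= Lg * S i.-1.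
Proof.
move=> i0; have /andP[Lg0 Lg1] := Lg_bounds.
have Cb0 : 0 < Cb * lam + 1.
  by rewrite addr_gt0// mulr_gt0// divr_gt0 ?exprn_gt0// mulr_gt0.
set P := \sum_(1 <= n < N.+1) normL2 (ep i n - ep i n.-1).1 ^+ 2.
have SP : (Cb * lam + 1) ^+ 2 * S i <= alpha ^+ 2 * P.
  rewrite !mulr_sumr; apply: ler_sum_nat => n /andP[n0]; rewrite ltnS => nN.
  have n1N : (n.-1 <= N)%N by exact: leq_trans (leq_pred _) nN.
  have [V1 W1 M1] := error_mem i0 nN; have [V2 W2 M2] := error_mem i0 n1N.
  have sys := homogeneous_systemB V1 V2 W1 W2 (Mh_L2 M1) (Mh_L2 M2)
    (error_elasticity i0 nN) (error_elasticity i0 n1N).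
  have := multiplier_le_pressure beta_gt0 infsup (VhB V1 V2) (WhB W1 W2)
    (Mh_L2 (MhB M1 M2)) sys.
  rewrite -!exprMn ler_sqr// nnegrE mulr_ge0 ?sqrtr_ge0//; exact: ltW.
have PS : a3 * P <= alpha ^+ 2 / (lam ^+ 2 * a3) * S i.-1.
  apply: le_trans (iteration_energy i0); rewrite lerDl.
  by rewrite !mulr_ge0 ?(semi_inner_ge0 gradP)// ltW.
apply: (@le_trans _ _ (Lg * (Lg * S i.-1))); last first.
  apply: ler_wpM2l; first exact: ltW.
  by rewrite ler_piMl ?S_ge0//; exact: ltW.
have D0 : 0 < (Cb * lam + 1) ^+ 2 * a3 by rewrite mulr_gt0// exprn_gt0.
rewrite -(ler_pM2l D0).
have -> : (Cb * lam + 1) ^+ 2 * a3 * (Lg * (Lg * S i.-1)) =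
    alpha ^+ 2 * (alpha ^+ 2 / (lam ^+ 2 * a3) * S i.-1).
  have a30 : c0 B * lam + alpha ^+ 2 != 0.
    by rewrite gt_eqF// ltr_wpDl ?exprn_gt0// mulr_ge0// ltW.
  rewrite /Lg /a3; move: Cb0; set C := Cb => Cb0; field.
  by rewrite a30 !gt_eqF.
apply: (@le_trans _ _ (alpha ^+ 2 * (a3 * P))).
  have -> : (Cb * lam + 1) ^+ 2 * a3 * S i = a3 * ((Cb * lam + 1) ^+ 2 * S i).
    by ring.
  by rewrite [leRHS]mulrCA; apply: ler_wpM2l => //; exact: ltW.
by apply: ler_wpM2l => //; rewrite exprn_ge0// ltW.
Qed.

(** The gradient term of the energy controls the full H^1 norm by Poincare's
    inequality. *)
Lemma pressure_bound (CP : R) i : (0 < i)%N ->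
  (forall psi, H10 Om sigma (Gp B) psi ->
    normL2 psi.1 <= CP * norm_grad Om psi) ->
  normH1 Om (ep i N) ^+ 2 <=
  (CP ^+ 2 + 1) * (alpha ^+ 2 / (lam ^+ 2 * a3)) / (dt * kp) * S i.-1.
Proof.
move=> i0 poin; have [_ _ M] := error_mem i0 (leqnn N).
have G0 := semi_inner_ge0 gradP (ep i N).
have GE : norm_grad Om (ep i N) ^+ 2 = grad_ip Om (ep i N) (ep i N).
  rewrite (norm_gradE mOm) ?(sqr_seminorm gradP)// => j; exact: Mh_grad_L2.
have PG : normL2 (ep i N).1 ^+ 2 <= CP ^+ 2 * grad_ip Om (ep i N) (ep i N).
  rewrite -GE -exprMn; have PB := poin _ (let: And3 h _ _ := M in h).
  rewrite ler_sqr// nnegrE ?sqrtr_ge0//.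
  by apply: le_trans PB; exact: sqrtr_ge0.
have GS : dt * kp * grad_ip Om (ep i N) (ep i N) <=
    alpha ^+ 2 / (lam ^+ 2 * a3) * S i.-1.
  apply: le_trans (iteration_energy i0); rewrite lerDr.
  apply: mulr_ge0; first exact: ltW.
  by apply: sumr_ge0 => n _; rewrite exprn_ge0// sqrtr_ge0.
have dk : 0 < dt * kp by rewrite mulr_gt0.
rewrite /normH1 sqr_sqrtr; last by rewrite addr_ge0// exprn_ge0// sqrtr_ge0.
rewrite GE; apply: (@le_trans _ _ ((CP ^+ 2 + 1) * grad_ip Om (ep i N) (ep i N))).
  by rewrite mulrDl mul1r lerD2r.
have -> : (CP ^+ 2 + 1) * (alpha ^+ 2 / (lam ^+ 2 * a3)) / (dt * kp) * S i.-1 =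
   (CP ^+ 2 + 1) * (alpha ^+ 2 / (lam ^+ 2 * a3) * S i.-1 / (dt * kp)) by ring.
apply: ler_wpM2l; first by rewrite addr_ge0// sqr_ge0.
by rewrite ler_pdivlMr// mulrC.
Qed.

Lemma multiplier_bound i : (0 < i)%N ->
  normL2 (exi i N) <= 2 * mu / beta * normH1v Om (eu i N).
Proof.
move=> i0; have [V W M] := error_mem i0 (leqnn N).
have sys := error_elasticity i0 (leqnn N).
rewrite -(ler_pM2l beta_gt0).
apply: (le_trans (infsup_multiplier_le infsup V W sys)).
have -> : beta * (2 * mu / beta * normH1v Om (eu i N)) =
    2 * mu * normH1v Om (eu i N) by field; rewrite gt_eqF.
apply: ler_wpM2l; first by rewrite mulr_ge0// ltW.
by apply: norm_strain_le => // j; exact: Vh_H1.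
Qed.

Lemma displacement_bound (CK : R) i : (0 < i)%N ->
  (forall v, (forall j, H10 Om sigma (Gu B) (v j)) ->
    normH1v Om v <= CK * norm_strain Om v) ->
  normH1v Om (eu i N) <=
  (`|CK| + 1) * alpha / (lam * beta) * normH1 Om (ep i N).
Proof.
move=> i0 kornP; have [V W M] := error_mem i0 (leqnn N).
have sys := error_elasticity i0 (leqnn N).
have E := strain_le_pressure beta_gt0 infsup V W (Mh_L2 M) sys.
have lb : 0 < lam * beta by rewrite mulr_gt0.
have CK0 : 0 <= `|CK| + 1 by rewrite addr_ge0.
have e0 : 0 <= norm_strain Om (eu i N) by exact: sqrtr_ge0.
have pp : normL2 (ep i N).1 <= normH1 Om (ep i N).
  rewrite -[leLHS]ger0_norm ?sqrtr_ge0// -sqrtr_sqr; apply: ler_wsqrtr.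
  by rewrite lerDl sqr_ge0.
apply: (@le_trans _ _ ((`|CK| + 1) * norm_strain Om (eu i N))).
  apply: le_trans (kornP _ _) _; first by move=> j; have [] := V j.
  by apply: ler_wpM2r => //; have := ler_norm CK; lra.
have -> : (`|CK| + 1) * alpha / (lam * beta) * normH1 Om (ep i N) =
   (`|CK| + 1) * (alpha * normH1 Om (ep i N) / (lam * beta)) by ring.
apply: ler_wpM2l => //; rewrite ler_pdivlMr// mulrC; apply: (le_trans E).
by apply: ler_wpM2l => //; exact: ltW.
Qed.

End Iteration.

(** The schemes march forward in time, so stopping at an earlier level n gives
    the schemes for n steps; this transfers final-time estimates to level n. *)
Lemma truncation n (D : data R d) (dt : R) (N : nat) u xi p u0 xi0 p0 ui xii pii :
  (n <= N)%N ->
  coupled_solution B k l Th D dt N u xi p ->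
  decoupled_iterates B k l Th D dt N u0 xi0 p0 ui xii pii ->
  coupled_solution B k l Th D dt n u xi p /\
  decoupled_iterates B k l Th D dt n u0 xi0 p0 ui xii pii.
Proof.
move=> nN [mem eqs] [it0 i0 stepp stepe].
have nN' m : (m <= n)%N -> (m <= N)%N by move=> /leq_trans; exact.
have nN'' m : (0 < m <= n)%N -> (0 < m <= N)%N by move=> /andP[-> /nN'].
split; first by split=> m mn; [exact/mem/nN' | exact/eqs/nN''].
split=> //.
- by move=> m /nN'; exact: it0.
- by move=> i m ipos /nN''; exact: stepp.
- by move=> i m ipos /nN''; exact: stepe.
Qed.

End BiotEstimates.

(** * Geometric convergence *)

Lemma sqr_le_geometric_cvg0 (R : realType) (f : nat -> R) (a z : R) :
  0 <= z < 1 -> (forall i, 0 <= f i) -> (forall i, f i.+1 ^+ 2 <= a * z ^+ i) ->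
  f i @[i --> \oo] --> 0.
Proof.
move=> /andP[z0 z1] f0 fz; rewrite -cvg_shiftS.
apply: (squeeze_cvgr (f := fun=> 0) (h := fun i => Num.sqrt (geometric a z i))).
- near=> i; rewrite f0 /=.
  rewrite -[leLHS]ger0_norm ?f0// -sqrtr_sqr; exact: ler_wsqrtr.
- exact: cvg_cst.
- rewrite -[0 in X in _ --> X]sqrtr0.
  apply: (@continuous_cvg _ _ _ _ _ _ Num.sqrt); first exact: sqrt_continuous.
  by apply: cvg_geometric; rewrite ger0_norm.
Unshelve. all: by end_near. Qed.

Lemma le_cvg0 (R : realType) (f g : nat -> R) (C : R) :
  (forall i, (0 < i)%N -> 0 <= g i <= C * f i) ->
  f i @[i --> \oo] --> 0 -> g i @[i --> \oo] --> 0.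
Proof.
move=> fg f0.
apply: (squeeze_cvgr (f := fun=> 0) (h := fun i => C * f i)).
- by near=> i; apply: fg; near: i; exists 1%N.
- exact: cvg_cst.
- by rewrite -[0 in X in _ --> X](mulr0 C); exact: cvgMr.
Unshelve. all: by end_near. Qed.

Theorem theorem3p4 (R : realType) :
  exists Cbm : R -> R -> R,
    (forall beta m : R, 0 < beta -> 0 < m -> 0 < Cbm beta m) /\
    forall (d : nat) (B : biot R d),
      (d = 2%N \/ d = 3%N) -> admissible B -> korn B -> poincare B ->
    forall k l : nat, (2 <= k)%N -> (1 <= l)%N ->
    forall (I : Type) (Th : I -> seq 'M[R]_(d.+1, d)),
      (forall h, triangulates (Th h) (closure (Om B))) ->
    forall beta : R, 0 < beta -> (forall h, inf_sup B k (Th h) beta) ->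
    forall dt : R, 0 < dt ->
    let Lg := ((c0 B * lam B / alpha B ^+ 2 + 1) *
               (Cbm beta (mu B) * lam B + 1))^-1 in
    0 < Lg < 1 /\
    exists C1 C2 C3 : R, [/\ 0 < C1, 0 < C2, 0 < C3 &
    forall (N : nat) (T : R), (0 < N)%N -> T = N%:R * dt ->
    forall D : data R d, regular_data B T D ->
    forall (h : I)
      (u : nat -> wvec R d) (xi : nat -> 'rV[R]_d -> R) (p : nat -> wdiff R d)
      (ui : nat -> nat -> wvec R d) (xii : nat -> nat -> 'rV[R]_d -> R)
      (pii : nat -> nat -> wdiff R d),
      coupled_solution B k l (Th h) D dt N u xi p ->
      decoupled_iterates B k l (Th h) D dt N (u 0%N) (xi 0%N) (p 0%N)
        ui xii pii ->
    let eu i n := ui i n - u n in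
    let exi i n := xii i n - xi n in
    let ep i n := pii i n - p n in
    let S i := \sum_(1 <= n < N.+1)
                 normL2 (leb R d) (Om B) (exi i n - exi i n.-1) ^+ 2 in
    (forall n, (n <= N)%N ->
      [/\ normH1v (Om B) (eu i n) @[i --> \oo] --> 0,
          normL2 (leb R d) (Om B) (exi i n) @[i --> \oo] --> 0 &
          normH1 (Om B) (ep i n) @[i --> \oo] --> 0]) /\
    (forall i, (0 < i)%N ->
      [/\ S i <= Lg * S i.-1,
          normH1 (Om B) (ep i N) ^+ 2 <= C1 * S i.-1,
          normL2 (leb R d) (Om B) (exi i N) <= C2 * normH1v (Om B) (eu i N) &
          normH1v (Om B) (eu i N) <= C3 * normH1 (Om B) (ep i N)])].
Proof.
exists (fun beta m => beta ^+ 2 / (2 * m)); split=> [beta m b0 m0|].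
  by rewrite divr_gt0 ?exprn_gt0// mulr_gt0.
move=> d B _ adm [CK kornP] [CP poinP] k l _ _ I Th _ beta b0 infsup dt dt0 Lg.
have [_ _ _ [lam0 mu0 alpha0 kp0] c00] := adm.
split; first exact: Lg_bounds.
pose a3 := c0 B + alpha B ^+ 2 / lam B.
have a30 : 0 < a3 by rewrite ltr_wpDl// divr_gt0// exprn_gt0.
pose C1 := (CP ^+ 2 + 1) * (alpha B ^+ 2 / (lam B ^+ 2 * a3)) / (dt * kp B).
pose C2 := 2 * mu B / beta.
pose C3 := (`|CK| + 1) * alpha B / (lam B * beta).
have C1_gt0 : 0 < C1.
  by rewrite !mulr_gt0 ?invr_gt0 ?mulr_gt0 ?exprn_gt0// ltr_wpDl ?sqr_ge0.
exists C1, C2, C3; split=> //.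
- by rewrite !mulr_gt0 ?invr_gt0.
- by rewrite !mulr_gt0 ?invr_gt0 ?mulr_gt0// ltr_wpDl.
move=> N T _ _ D _ h u xi p ui xii pii coupled decoupled.
have bounds n : (n <= N)%N -> let S i := \sum_(1 <= m < n.+1)
    normL2 (leb R d) (Om B)
      ((xii i m - xi m) - (xii i m.-1 - xi m.-1)) ^+ 2 in
  forall i, (0 < i)%N ->
    [/\ S i <= Lg * S i.-1,
        normH1 (Om B) (pii i n - p n) ^+ 2 <= C1 * S i.-1,
        normL2 (leb R d) (Om B) (xii i n - xi n) <=
          C2 * normH1v (Om B) (ui i n - u n) &
        normH1v (Om B) (ui i n - u n) <= C3 * normH1 (Om B) (pii i n - p n)].
  move=> nN S i i0.
  have [cn dn] := truncation nN coupled decoupled; split.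
  - exact: (contraction adm b0 (infsup h) dt0 cn dn).
  - exact: (pressure_bound adm dt0 cn dn i0 poinP).
  - exact: (multiplier_bound adm b0 (infsup h) cn dn).
  - exact: (displacement_bound adm b0 (infsup h) cn dn i0 kornP).
move=> eu exi ep S; split=> [n nN|i i0]; last exact: bounds.
have /= bnd := bounds n nN.
pose Sn i := \sum_(1 <= m < n.+1)
  normL2 (leb R d) (Om B) ((xii i m - xi m) - (xii i m.-1 - xi m.-1)) ^+ 2.
have /andP[Lg0 Lg1] : 0 < Lg < 1 by exact: Lg_bounds.
have SnE i : Sn i <= Lg ^+ i * Sn 0%N.
  elim: i => [|i IH]; first by rewrite expr0 mul1r.
  have [SS _ _ _] := bnd i.+1 isT; apply: (le_trans SS).
  by rewrite exprS -mulrA; apply: ler_wpM2l => //; exact: ltW.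
have pcvg : normH1 (Om B) (ep i n) @[i --> \oo] --> 0.
  apply: (@sqr_le_geometric_cvg0 _ _ (C1 * Sn 0%N) Lg).
  - by rewrite Lg1 ltW.
  - by move=> i; exact: sqrtr_ge0.
  move=> i; have [_ pb _ _] := bnd i.+1 isT; apply: (le_trans pb).
  rewrite -mulrA; apply: ler_wpM2l; first exact: ltW.
  by rewrite mulrC; exact: SnE.
have ucvg : normH1v (Om B) (eu i n) @[i --> \oo] --> 0.
  apply: (@le_cvg0 _ _ _ C3 _ pcvg) => i i0; rewrite sqrtr_ge0 /=.
  by have [] := bnd i i0.
split=> //; apply: (@le_cvg0 _ _ _ C2 _ ucvg) => i i0; rewrite sqrtr_ge0 /=.
by have [] := bnd i i0.
Qed.
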